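(* Let $\pi = z\,\partial_x\wedge\partial_y$ on $\mathbb{R}^3$ (the linear Poisson structure associated with the Heisenberg Lie algebra), and let $R:=\frac{x}{2}\partial_x+\frac{y}{2}\partial_y+z\partial_z$. The Poisson cohomology classes of $(\mathbb{R}^3,\pi)$ are uniquely described by the following representatives (every multivector field of the listed form is a cocycle, and every class contains exactly one multivector field of the listed form): - degree $0$: the Casimir functions are the functions $f(z)$ with $f\in C^\infty(\mathbb{R})$; - degree $1$: $f(z)R+[g(x,y),\partial_x\wedge\partial_y]$ with $f\in C^\infty(\mathbb{R})$ and $g\in C^\infty_0(\mathbb{R}^2)$; - degree $2$: $[(g_1(x,y)+zg_2(x,y))\partial_z,\partial_x\wedge\partial_y]$ with $g_1,g_2\in C_0^\infty(\mathbb{R}^2)$; - degree $3$: $g(x,y)\,\partial_x\wedge\partial_y\wedge\partial_z$ with $g\in C^\infty(\mathbb{R}^2)$. With these representatives, the algebraic structure (wedge product and Schouten–Nijenhuis bracket on $H^\bullet(\mathbb{R}^3,\pi)$) is determined by performing the operations on representatives and using the following relations in $H^\bullet(\mathbb{R}^3,\pi)$, valid for all $h_0,h_1,h_2,h_3\in C^\infty(\mathbb{R}^3)$ for which the multivector fields on the left-hand side are $d_\pi$-closed (outer brackets denote cohomology classes): $$\big[[h_0(x,y,z),\partial_x\wedge\partial_y]\big]=\big[[h_0(x,y,0),\partial_x\wedge\partial_y]\big],$$ $$\big[[h_1(x,y,z)\partial_z,\partial_x\wedge\partial_y]+h_2(x,y,z)\partial_x\wedge\partial_y\big]=\big[[(h_1(x,y,0)+z(\partial_zh_1(x,y,0)-h_2(x,y,0)))\partial_z,\partial_x\wedge\partial_y]\big],$$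 $$\big[h_3(x,y,z)\,\partial_x\wedge\partial_y\wedge\partial_z\big]=\big[h_3(x,y,0)\,\partial_x\wedge\partial_y\wedge\partial_z\big].$$
   Context: For a Poisson structure $\pi$ on a manifold $M$ (a bivector field with $[\pi,\pi]=0$, where $[\cdot,\cdot]$ is the Schouten–Nijenhuis bracket), the Poisson cohomology $H^\bullet(M,\pi)$ is the cohomology of the complex $(\mathfrak{X}^\bullet(M),d_\pi:=[\pi,\cdot])$ of smooth multivector fields $\mathfrak{X}^\bullet(M)=\Gamma(\wedge^\bullet TM)$. The wedge product and Schouten–Nijenhuis bracket descend to $H^\bullet(M,\pi)$. Coordinates on $\mathbb{R}^3$ are $(x,y,z)$. $C^\infty_0(\mathbb{R}^m)$ denotes the smooth functions on $\mathbb{R}^m$ vanishing at the origin. *)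

(* Defs.v *)
From HB Require Import structures.
From mathcomp Require Import all_boot all_order all_algebra.
From mathcomp Require Import all_classical all_reals all_analysis.

Set Implicit Arguments.
Unset Strict Implicit.
Unset Printing Implicit Defensive.

Import Order.TTheory GRing.Theory Num.Theory.
Import numFieldNormedType.Exports.

Local Open Scope classical_set_scope.
Local Open Scope ring_scope.

(* [Ck k f] is the usual "f is k times continuously differentiable" when V is
   finite-dimensional; it is only used for V = R, R * R and 'rV[R]_n. *)
Fixpoint Ck (R : realType) (V : normedModType R) (k : nat) (f : V -> R) : Prop :=
  match k with
  | 0%N => continuous f
  | k'.+1 => (forall p, differentiable f p) /\
             (forall v, Ck k' (fun p => 'D_v f p))
  end.

Definition smooth (R : realType) (V : normedModType R) (f : V -> R) : Prop :=
  forall k, Ck k f.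

Section Multivectors.
Variables (R : realType) (n : nat).
Implicit Types (i : 'I_n) (A B S : {set 'I_n}) (f h : 'rV[R]_n -> R).

(* A (not necessarily homogeneous or smooth) section of the exterior algebra of
   T R^n: P A is the coefficient of d_{a_1} /\ ... /\ d_{a_p}, where
   A = {a_1 < ... < a_p} and d_a is the a-th coordinate vector field. *)
Notation mvf := ({set 'I_n} -> 'rV[R]_n -> R).
Implicit Types P Q : mvf.

Definition mvfield (p : nat) P : Prop :=
  (forall A, smooth (P A)) /\ (forall A, #|A| != p -> P A = 0).

Definition fn h : mvf := fun A x => if A == finset.set0 then h x else 0.

Definition scale h P : mvf := fun A x => h x * P A x.

Definition vf i : mvf := fun A _ => (A == finset.set1 i)%:R.

(* d_A /\ d_B = (-1)^(ninv A B) d_(A :|: B) for disjoint A and B. *)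
Definition ninv A B : nat := (\sum_(a in A) #|[pred b in B | (b < a)%N]|)%N.

Definition wedge P Q : mvf := fun S x =>
  \sum_(A : {set 'I_n} | A \subset S)
     (-1) ^+ ninv A (S :\: A) * (P A x * Q (S :\: A) x).

Definition pder i f : 'rV[R]_n -> R := fun x => 'D_(delta_mx 0 i) f x.

Definition mpder i P : mvf := fun A => pder i (P A).

(* Derivatives from the left and from the right with respect to the odd
   variable theta_i = d_i of the exterior algebra. *)
Definition ldiff i P : mvf := fun A x =>
  if i \in A then 0
  else (-1) ^+ #|[pred a in A | (a < i)%N]| * P (i |: A) x.

Definition rdiff i P : mvf := fun A x =>
  if i \in A then 0
  else (-1) ^+ #|[pred a in A | (i < a)%N]| * P (i |: A) x.

(* Schouten-Nijenhuis bracket, written as the canonical odd Poisson bracket in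
   the variables (x_i, theta_i).  On vector fields it is the Lie bracket,
   [X, h] = X(h) for a function h, and for P, Q of degrees p, q
     [P, Q] = - (-1)^((p-1)(q-1)) [Q, P],
     [P, Q /\ S] = [P, Q] /\ S + (-1)^((p-1)q) Q /\ [P, S]. *)
Definition schouten P Q : mvf := fun S x =>
  \sum_(i < n) (wedge (rdiff i P) (mpder i Q) S x
                - wedge (mpder i P) (ldiff i Q) S x).

Section Cohomology.
Variable pi : mvf.

Definition cocycle (p : nat) P : Prop := mvfield p P /\ schouten pi P = 0.

Definition coboundary (p : nat) P : Prop :=
  match p with
  | 0%N => P = 0
  | q.+1 => exists2 Q, mvfield q Q & P = schouten pi Q
  end.

Definition pclass (p : nat) P : set mvf :=
  [set Q | cocycle p Q /\ coboundary p (Q - P)].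

(* H^p(R^n, pi), as the set of cosets of cocycles modulo coboundaries. *)
Definition cohomology (p : nat) : set (set mvf) :=
  [set c | exists2 P, cocycle p P & c = pclass p P].

(* The operation induced by [op] on classes, with values in degree r. *)
Definition class_op (op : mvf -> mvf -> mvf) (r : nat) (c d : set mvf)
    : set mvf :=
  [set T | exists P Q, [/\ c P, d Q & pclass r (op P Q) T]].

Definition descends (op : mvf -> mvf -> mvf) (deg : nat -> nat -> nat) : Prop :=
  forall p q P Q, cocycle p P -> cocycle q Q ->
    cocycle (deg p q) (op P Q) /\
    class_op op (deg p q) (pclass p P) (pclass q Q)
      = pclass (deg p q) (op P Q).

(* Equalities of classes obtained from a list [rel] of relations by means of
   the equivalence and additive laws alone. *)
Inductive derivable_from (rel : nat -> mvf -> mvf -> Prop)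
    : nat -> mvf -> mvf -> Prop :=
| Der_rel p P Q : cocycle p P -> rel p P Q -> derivable_from rel p P Q
| Der_refl p P : cocycle p P -> derivable_from rel p P P
| Der_sym p P Q : derivable_from rel p P Q -> derivable_from rel p Q P
| Der_trans p P Q T : derivable_from rel p P Q -> derivable_from rel p Q T ->
    derivable_from rel p P T
| Der_add p P Q P' Q' : derivable_from rel p P Q ->
    derivable_from rel p P' Q' -> derivable_from rel p (P + P') (Q + Q').

End Cohomology.
End Multivectors.

Notation mvf R n := ({set 'I_n} -> 'rV[R]_n -> R).

(* [P, Q] has degree p + q - 1; when p = q = 0 it vanishes, so that degree 0
   can be used instead of -1. *)
Definition bracket_deg (p q : nat) : nat := (p + q).-1.

Section Heisenberg.
Variable R : realType.

Definition ix : 'I_3 := @Ordinal 3 0 isT.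
Definition iy : 'I_3 := @Ordinal 3 1 isT.
Definition iz : 'I_3 := @Ordinal 3 2 isT.

Definition xc (p : 'rV[R]_3) : R := p 0 ix.
Definition yc (p : 'rV[R]_3) : R := p 0 iy.
Definition zc (p : 'rV[R]_3) : R := p 0 iz.

Definition dx : mvf R 3 := vf ix.
Definition dy : mvf R 3 := vf iy.
Definition dz : mvf R 3 := vf iz.
Definition dxy : mvf R 3 := wedge dx dy.
Definition dxyz : mvf R 3 := wedge (wedge dx dy) dz.

Definition heis : mvf R 3 := scale zc dxy.

Definition eulerR : mvf R 3 :=
  scale (fun p => xc p / 2) dx + scale (fun p => yc p / 2) dy + scale zc dz.

(* f(z) and g(x, y) as functions on R^3. *)
Definition of_z (f : R -> R) : 'rV[R]_3 -> R := fun p => f (zc p).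
Definition of_xy (g : R * R -> R) : 'rV[R]_3 -> R := fun p => g (xc p, yc p).

(* h(x, y, 0) as a function on R^3. *)
Definition at_z0 (h : 'rV[R]_3 -> R) : 'rV[R]_3 -> R :=
  fun p => h (\row_j (if j == iz then 0 else p 0 j)).

Definition smooth0 (g : R * R -> R) : Prop := smooth g /\ g (0, 0) = 0.

(* There are no nonzero multivector fields of degree > 3 on R^3. *)
Definition representative (p : nat) (P : mvf R 3) : Prop :=
  match p with
  | 0%N => exists2 f : R -> R, smooth f & P = fn (of_z f)
  | 1%N => exists (f : R -> R) (g : R * R -> R), [/\ smooth f, smooth0 g &
      P = scale (of_z f) eulerR + schouten (fn (of_xy g)) dxy]
  | 2%N => exists (g1 g2 : R * R -> R), [/\ smooth0 g1, smooth0 g2 &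
      P = schouten
            (scale (fun q => of_xy g1 q + zc q * of_xy g2 q) dz) dxy]
  | 3%N => exists2 g : R * R -> R, smooth g & P = scale (of_xy g) dxyz
  | _ => P = 0
  end.

Inductive heis_relation : nat -> mvf R 3 -> mvf R 3 -> Prop :=
| Rel1 (h0 : 'rV[R]_3 -> R) : smooth h0 ->
    heis_relation 1 (schouten (fn h0) dxy) (schouten (fn (at_z0 h0)) dxy)
| Rel2 (h1 h2 : 'rV[R]_3 -> R) : smooth h1 -> smooth h2 ->
    heis_relation 2
      (schouten (scale h1 dz) dxy + scale h2 dxy)
      (schouten (scale (fun q => at_z0 h1 q
          + zc q * (at_z0 (pder iz h1) q - at_z0 h2 q)) dz) dxy)
| Rel3 (h3 : 'rV[R]_3 -> R) : smooth h3 ->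
    heis_relation 3 (scale h3 dxyz) (scale (at_z0 h3) dxyz).

End Heisenberg.

Arguments dx {R}.
Arguments dy {R}.
Arguments dz {R}.
Arguments dxy {R}.
Arguments dxyz {R}.
Arguments heis {R}.
Arguments eulerR {R}.

(* Main.v *)
(** With the coordinate fields as odd variables theta_1, theta_2, theta_3, the
    differential is z (theta_1 d_y - theta_2 d_x) - theta_1 theta_2 d/dtheta_3.
    Hence closed fields are controlled by the divergence in (x, y): a closed vector
    field is f(z) R plus a horizontal field that is divergence free, and the two
    coefficients containing d_z of a closed bivector field are divergence free.  By the
    Poincare lemma in the plane with parameter z such fields are Hamiltonian for
    d_x /\ d_y, so a cocycle of positive degree is literally the left-hand side of one of the
    relations, up to the summand f(z) R in degree 1.  Hamiltonians matter only modulo z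
    (modulo z^2 in degree 2), by Hadamard's lemma; uniqueness follows by restricting
    to z = 0. *)

Require Import Defs.
From HB Require Import structures.
From mathcomp Require Import all_boot all_order all_algebra.
From mathcomp Require Import all_classical all_reals all_analysis.
From mathcomp Require Import ring.
Import Order.TTheory GRing.Theory Num.Theory.
Import numFieldNormedType.Exports.
Local Open Scope classical_set_scope.
Local Open Scope ring_scope.

Set Implicit Arguments.
Unset Strict Implicit.
Unset Printing Implicit Defensive.

(** * Smooth functions *)

Section Smooth.
Variables (R : realType) (V : normedModType R).
Implicit Types (f g : V -> R) (k : nat) (p u v : V).

(** Algebra and analysis are kept apart. That [schouten heis] is a graded derivation of the wedge
    product and of the bracket is verified on eight coefficients over any commutative ring with
    three commuting derivations and an element z with derivatives 0, 0, 1; there [ring] decides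
    every identity. Smooth functions form such a ring once partial derivatives are known to commute.
    The main further analytic inputs are primitives along a coordinate that stay smooth in all
    variables, smooth division of h - h(x, y, 0) by z, and regularity of z. The first two come from
    one family of integrals over [0, 1], differentiated under the integral sign. The field R appears
    because closedness forces the z-coefficient of a vector field to be zF, where F is the
    divergence in (x, y), and F to depend on z alone; the horizontal part of R has divergence 1. In
    degree 2 one works modulo z^2 rather than z because representatives have no d_x d_y coefficient:
    a vector field whose differential is a difference of representatives must have a z-coefficient
    divisible by z, and the differential contributes a second factor z. *)

Lemma Ck_continuous k f : Ck k f -> continuous f.
Proof.
by case: k => [//|k] [df _] p; apply: differentiable_continuous.
Qed.

Lemma CkW k f : Ck k.+1 f -> Ck k f.
Proof.
elim: k f => [f /Ck_continuous//|k IH f [df Df]].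
by split=> // v; apply: IH.
Qed.

Lemma smooth_differentiable f p : smooth f -> differentiable f p.
Proof. by move=> sf; have [+ _] := sf 1%N; apply. Qed.

Lemma smooth_continuous f : smooth f -> continuous f.
Proof. by move=> /(_ 0%N). Qed.

Lemma smooth_derive f v : smooth f -> smooth ('D_v f).
Proof. by move=> sf k; have [_ +] := sf k.+1; apply. Qed.

Lemma Ck_cst k (c : R) : Ck k ((fun=> c) : V -> R).
Proof.
elim: k c => [|k IH] c /=; first exact: cst_continuous.
split=> [p|v]; first exact: differentiable_cst.
rewrite (_ : (fun p => 'D_v _ p) = fun=> 0); first exact: IH.
by apply/funext => p; rewrite derive_cst.
Qed.

Lemma CkD k f g : Ck k f -> Ck k g -> Ck k (f + g).
Proof.
elim: k f g => [|k IH] f g /=; first by move=> cf cg p; apply: cvgD; [apply: cf|apply: cg].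
move=> [df Df] [dg Dg]; split=> [p|v]; first exact: differentiableD.
rewrite (_ : (fun p => 'D_v _ p) = (fun p => 'D_v f p) + (fun p => 'D_v g p)); first exact: IH.
by apply/funext => p; rewrite deriveD//; apply: diff_derivable.
Qed.

Lemma CkM k f g : Ck k f -> Ck k g -> Ck k (f * g).
Proof.
elim: k f g => [|k IH] f g; first by move=> cf cg p; apply: cvgM; [apply: cf|apply: cg].
move=> cf cg; case: (cf) (cg) => [df Df] [dg Dg].
split=> [p|v]; first exact: differentiableM.
rewrite (_ : (fun p => 'D_v _ p) = f * (fun p => 'D_v g p) + g * (fun p => 'D_v f p)).
  by apply: CkD; apply: IH; [exact: CkW|exact: Dg|exact: CkW|exact: Df].
by apply/funext => p; rewrite deriveM//; apply: diff_derivable.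
Qed.

Lemma Ck_sum k (I : Type) (r : seq I) (P : pred I) (F : I -> V -> R) :
  (forall i, P i -> Ck k (F i)) -> Ck k (\sum_(i <- r | P i) F i).
Proof. by move=> cF; apply: big_rec => [|i f Pi]; [exact: Ck_cst|exact/CkD/cF]. Qed.

Lemma is_derive_line f p v (s : R) : differentiable f (p + s *: v) ->
  is_derive s 1 (fun t : R => f (p + t *: v)) ('D_v f (p + s *: v)).
Proof.
move=> df; have dfv : derivable f (p + s *: v) v by exact: diff_derivable.
have E : (fun h : R => h^-1 *: (((fun t : R => f (p + t *: v)) \o shift s) (h *: 1)
             - f (p + s *: v)))
        = (fun h : R => h^-1 *: ((f \o shift (p + s *: v)) (h *: v) - f (p + s *: v))).
  by apply/funext => h /=; rewrite [_%:A]mulr1 scalerDl addrCA.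
by split; rewrite ?/derivable ?/derive E.
Qed.

Lemma mvt_line f p v (h : R) : (forall q, differentiable f q) -> 0 < h ->
  exists2 c, 0 < c < h & f (p + h *: v) - f p = h * 'D_v f (p + c *: v).
Proof.
move=> df h0; pose g (t : R) := f (p + t *: v).
have dg (s : R) : is_derive s 1 g ('D_v f (p + s *: v)) by exact: is_derive_line.
have [c|c chi E] := @MVT _ g (fun s => 'D_v f (p + s *: v)) 0 h h0 (fun s _ => dg s).
  apply: derivable_within_continuous => x _; exact: (@ex_derive _ _ _ _ _ _ _ (dg x)).
exists c; first by rewrite in_itv in chi.
by move: E; rewrite /g scale0r addr0 subr0 mulrC.
Qed.

Lemma derive_eq0_line f v : (forall q, differentiable f q) ->
  (forall q, 'D_v f q = 0) -> forall p (t : R), f (p + t *: v) = f p.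
Proof.
move=> df D0 p t; have pos q (s : R) : 0 < s -> f (q + s *: v) = f q.
  move=> s0; have [c _] := mvt_line q v df s0; rewrite D0 mulr0 => /eqP.
  by rewrite subr_eq0 => /eqP.
have [t0|t0|->] := ltgtP t 0; last by rewrite scale0r addr0.
  have /(pos (p + t *: v)) : 0 < - t by rewrite oppr_gt0.
  by rewrite -addrA -scalerDl subrr scale0r addr0 => ->.
exact: pos.
Qed.

(** Localises the intermediate points produced by two successive uses of the mean value theorem:
    whatever they are, they lie in the given neighbourhood once the step h is small. *)
Lemma near_line2 p u v (P : set V) : (\forall q \near p, P q) ->
  \forall h \near (0 : R)^'+, forall a b, 0 < a < h -> 0 < b < h ->
    P (p + a *: u + b *: v).
Proof.
move=> /nbhs_ballP[e /= e0 He].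
have M0 : 0 < `|u| + `|v| + 1 by rewrite ltr_pwDr// addr_ge0.
near=> h => a b /andP[a0 ah] /andP[b0 bh]; apply: He.
have h0 : 0 < h by near: h; exact: nbhs_right_gt.
rewrite -ball_normE /= -addrA opprD addNKr normrN.
apply: (le_lt_trans (ler_normD _ _)); rewrite !normrZ !gtr0_norm//.
apply: (@le_lt_trans _ _ (h * `|u| + h * `|v|)).
  by apply: lerD; apply: ler_wpM2r => //; apply: ltW.
apply: (@lt_le_trans _ _ (h * (`|u| + `|v| + 1))).
  by rewrite -mulrDr ltr_pM2l// ltrDl.
rewrite -ler_pdivlMr//; apply: ltW; near: h; apply: nbhs_right_lt; exact: divr_gt0.
Unshelve. all: by end_near. Qed.

(* Both mixed derivatives are limits of the second difference
   [f (p + h u + h v) - f (p + h u) - f (p + h v) + f p] divided by [h ^ 2]. *)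
Lemma derive_comm f p u v : smooth f -> 'D_u ('D_v f) p = 'D_v ('D_u f) p.
Proof.
move=> sf; have key (f' := f) a b (h : R) : 0 < h ->
    exists2 cd : R * R, (0 < cd.1 < h) /\ (0 < cd.2 < h) &
      f (p + h *: a + h *: b) - f (p + h *: a) - f (p + h *: b) + f p
      = h * (h * 'D_b ('D_a f) (p + cd.1 *: a + cd.2 *: b)).
  move=> h0; pose g q := f (h *: b + q) - f q.
  have dsh q : differentiable (fun x => f (h *: b + x)) q.
    apply: (@differentiable_comp _ _ _ _ (fun x => h *: b + x) f).
      by apply: differentiableD.
    exact: smooth_differentiable.
  have dg q : differentiable g q.
    by apply: differentiableB => //; exact: smooth_differentiable.
  have Dg q : 'D_a g q = 'D_a f (q + h *: b) - 'D_a f q.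
    rewrite deriveB; last 2 first.
    - exact: diff_derivable.
    - by apply/diff_derivable/smooth_differentiable.
    congr (_ - _); rewrite /derive; do 2 f_equal; apply/funext => s /=.
    by rewrite addrCA [h *: b + _]addrC.
  have [c cI E1] := mvt_line p a dg h0.
  have [d dI E2] := mvt_line (p + c *: a) b
    (fun q => smooth_differentiable q (smooth_derive a sf)) h0.
  exists (c, d) => //=; rewrite -E2 -Dg -E1 /g.
  by rewrite [h *: b + (_ + _)]addrC [h *: b + _]addrC; ring.
apply/eqP; rewrite -subr_eq0 -normr_le0; apply/ler_addgt0Pr => e e0; rewrite add0r.
have e2 : 0 < e / 2 by rewrite divr_gt0.
have triangle (x y z w : R) : z = w -> `|x - w| < e / 2 -> `|y - z| < e / 2 ->
    `|x - y| <= e.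
  move=> -> xw yw; rewrite (le_trans (ler_distD w _ _))// [leRHS]splitr.
  by apply: lerD; apply: ltW => //; rewrite distrC.
have c1 := smooth_continuous (smooth_derive u (smooth_derive v sf)).
have c2 := smooth_continuous (smooth_derive v (smooth_derive u sf)).
have N1 : \forall h \near (0 : R)^'+, forall a b, 0 < a < h -> 0 < b < h ->
    `|'D_u ('D_v f) p - 'D_u ('D_v f) (p + a *: v + b *: u)| < e / 2.
  apply: (@near_line2 p v u (fun q => `|'D_u ('D_v f) p - 'D_u ('D_v f) q| < e / 2)).
  by have /cvgrPdist_lt := c1 p; apply.
have N2 : \forall h \near (0 : R)^'+, forall a b, 0 < a < h -> 0 < b < h ->
    `|'D_v ('D_u f) p - 'D_v ('D_u f) (p + a *: u + b *: v)| < e / 2.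
  apply: (@near_line2 p u v (fun q => `|'D_v ('D_u f) p - 'D_v ('D_u f) q| < e / 2)).
  by have /cvgrPdist_lt := c2 p; apply.
have [h [h0 [{}N1 {}N2]]] := filter_ex (filterI (nbhs_right_gt (0 : R)) (filterI N1 N2)).
have [[a b] /= [aI bI] E1] := key u v h h0.
have [[c d] /= [cI dI] E2] := key v u h h0.
(* The intermediate points of the two expansions differ, but the second difference they expand is
   symmetric in u and v. *)
have E : 'D_v ('D_u f) (p + a *: u + b *: v) = 'D_u ('D_v f) (p + c *: v + d *: u).
  have : h * (h * 'D_v ('D_u f) (p + a *: u + b *: v))
       = h * (h * 'D_u ('D_v f) (p + c *: v + d *: u)).
    apply: etrans (esym E1) _; apply: etrans E2.
    by rewrite [p + h *: v + _]addrAC; congr (_ + _); exact: addrAC.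
  have hn : h != 0 by rewrite gt_eqF.
  by move=> /(mulfI hn)/(mulfI hn).
exact: (triangle _ _ _ _ E (N1 _ _ cI dI) (N2 _ _ aI bI)).
Qed.

End Smooth.

(** * Composition with continuous linear maps *)

Section SmoothComp.
Variables (R : realType) (V W : normedModType R) (L : V -> W).
Hypotheses (linL : linear L) (contL : continuous L).

Let L' : {linear V -> W} := HB.pack L (GRing.isLinear.Build _ _ _ _ _ linL).

Lemma differentiable_lin p : differentiable L p.
Proof. exact: (@linear_differentiable _ _ _ L'). Qed.

Lemma derive_comp_linear (f : W -> R) p v :
  (forall q, differentiable f q) -> 'D_v (f \o L) p = 'D_(L v) f (L p).
Proof.
move=> df; rewrite !deriveE//; last first.
  by apply: differentiable_comp => //; exact: differentiable_lin.
rewrite diff_comp//; last exact: differentiable_lin.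
by rewrite /= (@diff_lin _ _ _ L').
Qed.

Lemma smooth_comp_linear (f : W -> R) : smooth f -> smooth (f \o L).
Proof.
move=> sf k; elim: k f sf => [|k IH] f sf /=.
  by move=> p; apply: continuous_comp; [exact: contL|exact: smooth_continuous].
have df q := smooth_differentiable q sf.
split=> [p|v]; first by apply: differentiable_comp => //; exact: differentiable_lin.
rewrite (_ : (fun p => 'D_v _ p) = 'D_(L v) f \o L); first exact/IH/smooth_derive.
by apply/funext => p; rewrite derive_comp_linear.
Qed.

End SmoothComp.

Lemma smooth_linear (R : realType) (V : normedModType R) (L : V -> R) :
  linear L -> continuous L -> smooth L.
Proof.
move=> linL contL [//|k]; split=> [p|v]; first exact: differentiable_lin.
rewrite (_ : (fun p => 'D_v _ p) = fun=> L v); first exact: Ck_cst.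
apply/funext => p; rewrite (@derive_comp_linear _ _ _ _ linL contL id) ?derive_id//.
Qed.

(** * Integrals depending on a parameter *)

Section ParametricIntegral.
Variable R : realType.
Notation mu := (@lebesgue_measure R).

Definition int01 (f : R -> R) : R := \int[mu]_(t in `[0, 1]) f t.

Lemma integrable01 (f : R -> R) : continuous f -> mu.-integrable `[0, 1] (EFin \o f).
Proof.
move=> cf; apply: continuous_compact_integrable; first exact: segment_compact.
exact: continuous_subspaceT.
Qed.

Lemma int01D (f g : R -> R) : continuous f -> continuous g ->
  int01 (fun t => f t + g t) = int01 f + int01 g.
Proof. by move=> cf cg; apply: RintegralD => //; exact: integrable01. Qed.

Lemma int01B (f g : R -> R) : continuous f -> continuous g ->
  int01 (fun t => f t - g t) = int01 f - int01 g.
Proof. by move=> cf cg; apply: RintegralB => //; exact: integrable01. Qed.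

Lemma int01Z (c : R) (f : R -> R) : continuous f ->
  int01 (fun t => c * f t) = c * int01 f.
Proof. by move=> cf; apply: RintegralZl => //; exact: integrable01. Qed.

Lemma continuous_sumr (T : topologicalType) m (F : 'I_m -> T -> R) :
  (forall i, continuous (F i)) -> continuous (fun t => \sum_i F i t).
Proof.
move=> cF; rewrite (_ : (fun t => _) = \sum_i F i); last first.
  by apply/funext => t; rewrite fct_sumE.
apply: (big_ind (fun f : T -> R => continuous f)) => [|f g cf cg t|i _];
  [exact: cst_continuous| |exact: cF].
by apply: cvgD; [exact: cf|exact: cg].
Qed.

Lemma int01_sum n (F : 'I_n -> R -> R) : (forall i, continuous (F i)) ->
  int01 (fun t => \sum_i F i t) = \sum_i int01 (F i).
Proof.
elim: n F => [|n IH] F cF.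
  rewrite big_ord0; under [int01 _]eq_Rintegral do rewrite big_ord0.
  by rewrite Rintegral_cst// mul0r.
rewrite big_ord_recl -IH// -int01D//.
  by apply: eq_Rintegral => t _; rewrite big_ord_recl.
exact: continuous_sumr.
Qed.

Lemma int01_bound (f : R -> R) (M : R) : continuous f ->
  (forall t, 0 <= t <= 1 -> `|f t| <= M) -> `|int01 f| <= M.
Proof.
move=> cf fM; apply: (le_trans (le_normr_Rintegral _ _)) => //.
  exact: integrable01.
have cn : continuous (fun t => `|f t|).
  by move=> x; apply: continuous_comp; [exact: cf|exact: norm_continuous].
apply: (@le_trans _ _ (int01 (fun=> M))).
  by apply: le_Rintegral => //; [exact: integrable01|apply: integrable01; exact: cst_continuous].
rewrite /int01 Rintegral_cst//.
have := lebesgue_measure_itv `[(0 : R), 1]%R; rewrite /= lte_fin ltr01 => ->.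
by rewrite -EFinB/= subr0 mulr1.
Qed.

Lemma int01_FTC (F f : R -> R) : continuous f ->
  (forall t : R, is_derive t 1 F (f t)) -> int01 f = F 1 - F 0.
Proof.
move=> cf dF; have dF' (t : R) : differentiable F t.
  by apply/derivable1_diffP; exact: (@ex_derive _ _ _ _ _ _ _ (dF t)).
rewrite /int01 /Rintegral (@continuous_FTC2 _ f F)//.
- exact: continuous_subspaceT.
- split=> [x _||]; first exact/derivable1_diffP.
    by apply: cvg_at_right_filter; apply: differentiable_continuous.
  by apply: cvg_at_left_filter; apply: differentiable_continuous.
- by move=> t _; rewrite derive1E; exact: (@derive_val _ _ _ _ _ _ _ (dF t)).
Qed.

Variable n : nat.
Notation V := 'rV[R]_n.

Lemma joint_left (W : normedModType R) (G : R -> W -> R) q :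
  continuous (fun x : R * W => G x.1 x.2) -> continuous (G ^~ q).
Proof.
move=> cG t; apply: (@continuous_comp _ _ _ (fun t => (t, q)) (fun x : R * W => G x.1 x.2));
  last exact: cG.
apply: (@cvg_pair _ _ _ (nbhs t) (nbhs t) (nbhs q) _ _ _ id (fun=> q)).
  exact: cvg_id.
exact: cvg_cst.
Qed.

(** Compactness of [0, 1]: joint continuity gives the estimate near each (t, p), and the
    near-covering form of compactness makes one neighbourhood of p serve every t. *)
Lemma uniform_near01 (W : normedModType R) (G : R -> W -> R) (p : W) (e : R) :
  continuous (fun x : R * W => G x.1 x.2) -> 0 < e ->
  \forall q \near p, forall t, 0 <= t <= 1 -> `|G t q - G t p| < e.
Proof.
move=> cG e0; have /compact_near_coveringP C := @segment_compact R 0 1.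
have e2 : 0 < e / 2 by rewrite divr_gt0.
have := C _ (nbhs p) (fun q t => `|G t q - G t p| < e) _ _.
have H t : t \in `[(0 : R), 1] ->
    \forall t' \near t & q \near p, `|G t' q - G t' p| < e.
  move=> _; have /cvgrPdist_lt/(_ _ e2) N1 := cG (t, p).
  have /cvgrPdist_lt/(_ _ e2) N2 := (@joint_left _ _ p cG) t.
  case: N1 => [[P1 P2] [/= n1 n2] H1].
  exists (P1 `&` [set t' | `|G t p - G t' p| < e / 2], P2).
    by split=> //; apply: filterI.
  move=> [t' q] /= [[P1t' Ht'] P2q].
  rewrite (le_lt_trans (ler_distD (G t p) _ _))// [ltRHS]splitr ltrD//.
  by rewrite distrC; exact: (H1 (t', q)).
move=> /(_ _ H); apply: filterS => q Hq t tI; apply: Hq.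
by rewrite /= in_itv.
Qed.

Lemma le_coord_mx_norm (v : V) j : `|v 0 j| <= `|v|.
Proof.
rewrite [leRHS]/Num.norm /= mx_normrE.
exact: (le_bigmax _ (fun ij : 'I_1 * 'I_n => `|v ij.1 ij.2|) (0, j)).
Qed.

(** Differentiation under the integral sign, for the full differential since [Ck] asks for
    [differentiable]. For each t the mean value theorem turns the remainder into increments of the
    partial derivatives, and [uniform_near01] makes these small for all t at once. *)
Lemma int01_param (G : R -> V -> R) (dG : 'I_n -> R -> V -> R) :
  continuous (fun x : R * V => G x.1 x.2) ->
  (forall j, continuous (fun x : R * V => dG j x.1 x.2)) ->
  (forall t q, differentiable (G t) q) ->
  (forall j t q, 'D_(delta_mx 0 j) (G t) q = dG j t q) ->
  forall p, differentiable (fun q => int01 (G ^~ q)) p /\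
    forall v, 'D_v (fun q => int01 (G ^~ q)) p
              = \sum_j v 0 j * int01 (dG j ^~ p).
Proof.
move=> cG cdG dfG DG p; set F := fun q => _.
pose L (v : V) := \sum_j v 0 j * int01 (dG j ^~ p).
have linL : linear L.
  move=> a u v; rewrite /L scaler_sumr -big_split; apply: eq_bigr => j _ /=.
  by rewrite !mxE mulrDl scalerAl.
have contL : continuous L.
  apply: continuous_sumr => j x.
  have cj : {for x, continuous (fun v : V => v 0 j)} by exact: coord_continuous.
  by apply: (continuousM cj); exact: cst_continuous.
pose L' : {linear V -> R} := HB.pack L (GRing.isLinear.Build _ _ _ _ _ linL).
have DGv t q (v : V) : 'D_v (G t) q = \sum_j v 0 j * dG j t q.
  rewrite deriveE// [v in LHS]row_sum_delta linear_sum; apply: eq_bigr => j _.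
  by rewrite linearZ -DG deriveE.
suff E : F \o shift p = cst (F p) + L' +o_ 0 id.
  have dE : 'd F p = L' :> (V -> R) by exact: diff_unique.
  have dF : differentiable F p by apply/diff_locallyP; rewrite dE.
  by split=> // v; rewrite deriveE// dE.
apply/eqaddoP => _/posnumP[e].
(* The remainder is a sum of n terms, each at most e' times the norm of h; n + 1 keeps the
   denominator nonzero when n = 0. *)
pose e' := e%:num / n.+1%:R.
have e'0 : 0 < e' by rewrite divr_gt0.
have /nbhs_ballP[d /= d0 Hd] : \forall q \near p, forall j t, 0 <= t <= 1 ->
    `|dG j t q - dG j t p| < e'.
  exact: (@filter_forall V 'I_n _ (nbhs p) _ (fun j => uniform_near01 p (cdG j) e'0)).
near=> h.
have hd : `|h| < d by near: h; exact: (@nbhs0_lt _ V d d0).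
have cGq q : continuous (G ^~ q) by exact: joint_left.
have cj j : continuous (fun t => h 0 j * dG j t p).
  move=> t; apply: (continuousM (@cst_continuous R R (h 0 j) t)).
  exact: (@joint_left _ _ p (cdG j)).
have cS : continuous (fun t => \sum_j h 0 j * dG j t p) by exact: continuous_sumr.
have cB : continuous (fun t => G t (p + h) - G t p).
  by move=> t; apply: continuousB; exact: cGq.
rewrite /= !fctE /=.
have -> : F (h + p) - (F p + L h) = int01 (fun t => G t (p + h) - G t p 
                               - \sum_j h 0 j * dG j t p).
  rewrite (int01B cB cS) int01B// int01_sum// [h + p]addrC opprD addrA; congr (_ - _).
  by apply: eq_bigr => j _; rewrite int01Z//; exact: (@joint_left _ _ p (cdG j)).
apply: int01_bound; first by move=> t; exact: (continuousB (cB t) (cS t)).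
(* The remainder at t is the sum over j of h_j times the increment of [dG j t] from p to p + c h. *)
move=> t tI; have [c /andP[c0 c1]] := mvt_line p h (dfG t) ltr01.
rewrite scale1r mul1r DGv => ->; rewrite -sumrB.
apply: (le_trans (ler_norm_sum _ _ _)).
apply: (@le_trans _ _ (\sum_(j < n) e' * `|h|)).
  apply: ler_sum => j _; rewrite -mulrBr normrM mulrC.
  apply: ler_pM => //.
    apply/ltW/Hd => //; rewrite -ball_normE/= opprD addNKr normrN normrZ gtr0_norm//.
    by apply: le_lt_trans hd; rewrite ler_piMl// ltW.
  exact: le_coord_mx_norm.
rewrite sumr_const card_ord -mulrnAl ler_wpM2r//.
rewrite /e' -mulr_natr -mulrA ler_piMr//.
by rewrite mulrC ler_pdivrMr// mul1r ler_nat.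
Unshelve. all: by end_near. Qed.
End ParametricIntegral.

(** * Hadamard quotients and primitives along a coordinate *)

Section CoordinateScaling.
Variables (R : realType) (n : nat) (i : 'I_n).
Notation V := 'rV[R]_n.
Notation E j := (@delta_mx R 1 n 0 j).
Implicit Types (f : V -> R) (p q v : V) (t : R) (m k : nat).

(** Multiplies the i-th coordinate by t: the identity at t = 1, the projection onto the hyperplane
    p_i = 0 at t = 0. *)
Definition scale_coord t p : V := p + ((t - 1) * p 0 i) *: (E i).

(* [parint 0 ('D_(E i) f)] is the Hadamard quotient of [f] in the [i]-th
   coordinate; the weight makes the family stable under differentiation. *)
Definition parint m f p : R := int01 (fun t => t ^+ m * f (scale_coord t p)).

Lemma scale_coord_linear t : linear (scale_coord t).
Proof.
move=> a u v; rewrite /scale_coord !mxE scalerDr scalerA addrACA -scalerDl.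
by congr (_ + _ *: _); rewrite mulrDr mulrCA.
Qed.

Lemma scale_coordE t p : scale_coord t p = scale_coord 0 p + t *: (p 0 i *: (E i)).
Proof.
rewrite /scale_coord -addrA scalerA -scalerDl; congr (_ + _ *: _); ring.
Qed.

Lemma scale_coord1 p : scale_coord 1 p = p.
Proof. by rewrite /scale_coord subrr mul0r scale0r addr0. Qed.

Lemma scale_coord_delta t j : scale_coord t (E j) = t ^+ (j == i) *: (E j).
Proof.
rewrite /scale_coord mxE eqxx /= eq_sym; case: eqP => [->|_] /=.
  by rewrite mulr1 -{1}(scale1r (E i)) -scalerDl addrC subrK expr1.
by rewrite mulr0 scale0r addr0 expr0 scale1r.
Qed.

Lemma scale_coord_continuous2 : continuous (fun x : R * V => scale_coord x.1 x.2).
Proof.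
move=> x; have c1 : {for x, continuous (fun x : R * V => x.1)} by exact: cvg_fst.
have c2 : {for x, continuous (fun x : R * V => x.2)} by exact: cvg_snd.
suff c3 : {for x, continuous (fun x : R * V => ((x.1 - 1) * x.2 0 i) *: (E i))}.
  exact: (continuousD c2 c3).
apply: (@continuous_comp _ _ _ (fun x : R * V => (x.1 - 1) * x.2 0 i)
          (fun s : R => s *: (E i))); last exact: scalel_continuous.
apply: (@continuousM _ _ (fun x : R * V => x.1 - 1) (fun x : R * V => x.2 0 i)).
  apply: (@continuousB _ _ _ (fun x : R * V => x.1) (fun=> 1)) => //.
  exact: cst_continuous.
apply: (@continuous_comp _ _ _ (fun x : R * V => x.2) (fun v : V => v 0 i)) => //.
exact: coord_continuous.
Qed.

Lemma scale_coord_continuous t : continuous (scale_coord t).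
Proof.
move=> p; apply: (@continuous_comp _ _ _ (fun p => (t, p))
  (fun x : R * V => scale_coord x.1 x.2)); last exact: scale_coord_continuous2.
apply: (@cvg_pair _ _ _ (nbhs p) (nbhs t) (nbhs p) _ _ _ (fun=> t) id).
  exact: cvg_cst.
exact: cvg_id.
Qed.

Lemma parint_continuous2 m f : continuous f ->
  continuous (fun x : R * V => x.1 ^+ m * f (scale_coord x.1 x.2)).
Proof.
move=> cf x.
apply: (@continuousM _ _ (fun x : R * V => x.1 ^+ m)
  (fun x : R * V => f (scale_coord x.1 x.2))).
  apply: (@continuous_comp _ _ _ (fun x : R * V => x.1) (fun s : R => s ^+ m)).
    exact: cvg_fst.
  exact: exprn_continuous.
apply: (@continuous_comp _ _ _ (fun x : R * V => scale_coord x.1 x.2) f).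
  exact: scale_coord_continuous2.
exact: cf.
Qed.

Lemma parint_continuous m f p : continuous f ->
  continuous (fun t => t ^+ m * f (scale_coord t p)).
Proof.
move=> cf; have c2 := parint_continuous2 (m := m) cf.
exact: (@joint_left _ _ (fun t q => t ^+ m * f (scale_coord t q)) p c2).
Qed.

(** By the chain rule, differentiating f along the scaled point in direction i yields an extra
    factor t, whence the weight m + 1; the other directions leave the weight unchanged. *)
Lemma parint_derive m f : smooth f ->
  forall p, differentiable (parint m f) p /\ forall v, 'D_v (parint m f) p
    = \sum_j v 0 j * parint (m + (j == i)) ('D_(E j) f) p.
Proof.
move=> sf; have df q : differentiable f q by exact: smooth_differentiable.
have dfc t q : differentiable (f \o scale_coord t) q.
  exact: (differentiable_comp (differentiable_lin (scale_coord_linear t)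
    (scale_coord_continuous (t := t)) q) (df _)).
apply: (int01_param (G := fun t q => t ^+ m * f (scale_coord t q))
  (dG := fun j t q => t ^+ (m + (j == i)) * 'D_(E j) f (scale_coord t q))).
- exact: (parint_continuous2 (smooth_continuous sf)).
- by move=> j; exact: (parint_continuous2 (smooth_continuous (smooth_derive _ sf))).
- move=> t q; exact: (differentiableZ (t ^+ m) (dfc t q)).
- move=> j t q.
  have -> : (fun q => t ^+ m * f (scale_coord t q)) = t ^+ m *: (f \o scale_coord t) by [].
  rewrite deriveZ; last exact: diff_derivable.
  rewrite (derive_comp_linear (scale_coord_linear t) (scale_coord_continuous (t := t)) _ _ df).
  rewrite scale_coord_delta deriveE// linearZ -deriveE// exprD.
  by rewrite scalerA.
Qed.

(** The induction on k keeps m and f general, because a derivative of [parint m f] is a combination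
    of such integrals for the partial derivatives of f and possibly a larger weight. *)
Lemma parint_smooth m f : smooth f -> smooth (parint m f).
Proof.
move=> sf k; elim: k m f sf => [|k IH] m f sf.
  by move=> p; have [dp _] := parint_derive m sf p; exact: differentiable_continuous.
split=> [p|v]; first by have [] := parint_derive m sf p.
rewrite (_ : (fun p => 'D_v _ p)
  = \sum_j (fun=> v 0 j) * parint (m + (j == i)) ('D_(E j) f)); last first.
  apply/funext => p; have [_ ->] := parint_derive m sf p.
  by rewrite fct_sumE.
apply: Ck_sum => j _; apply: CkM; first exact: Ck_cst.
exact/IH/smooth_derive.
Qed.

Lemma scale_coord_is_derive f p t : smooth f ->
  is_derive t 1 (fun t => f (scale_coord t p))
    (p 0 i * 'D_(E i) f (scale_coord t p)).
Proof.
move=> sf; have df q : differentiable f q by exact: smooth_differentiable.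
have -> : (fun t => f (scale_coord t p))
        = (fun t => f (scale_coord 0 p + t *: (p 0 i *: (E i)))).
  by apply/funext => s; rewrite scale_coordE.
rewrite [scale_coord t p]scale_coordE.
apply: (is_derive_eq (is_derive_line (df _))).
by rewrite deriveE// linearZ -deriveE.
Qed.

(** The fundamental theorem of calculus for t |-> f (scale_coord t p) between 0 and 1. *)
Lemma parint_hadamard f p : smooth f ->
  p 0 i * parint 0 ('D_(E i) f) p = f p - f (scale_coord 0 p).
Proof.
move=> sf; have sDf := smooth_derive (E i) sf.
have c0 := parint_continuous (m := 0) (p := p) (smooth_continuous sDf).
have cp : continuous (fun t => p 0 i * (t ^+ 0 * 'D_(E i) f (scale_coord t p))).
  by move=> t; exact: (continuousM (@cst_continuous R R (p 0 i) t) (c0 t)).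
rewrite -int01Z//.
have dF t : is_derive t 1 (fun t => f (scale_coord t p))
    (p 0 i * (t ^+ 0 * 'D_(E i) f (scale_coord t p))).
  by apply: (is_derive_eq (scale_coord_is_derive p t sf)); rewrite expr0 mul1r.
by rewrite (int01_FTC cp dF) scale_coord1.
Qed.

(** After the substitution s = t p_i this is the integral of f along the i-th direction from the
    hyperplane p_i = 0 to p, written over a domain that does not move with p. *)
Definition primitive f p : R := p 0 i * parint 0 f p.

Lemma coord_smooth j : smooth (fun p => p 0 j).
Proof.
apply: smooth_linear; last exact: coord_continuous.
by move=> a u v; rewrite !mxE.
Qed.

Lemma derive_coord j v p : 'D_v (fun p => p 0 j) p = v 0 j.
Proof.
have linc : linear (fun p : V => p 0 j : R) by move=> a u w; rewrite !mxE.
by rewrite (@derive_comp_linear _ _ _ _ linc (@coord_continuous _ _ _ _ _) id) ?derive_id.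
Qed.

Lemma primitive_smooth f : smooth f -> smooth (primitive f).
Proof. by move=> sf k; apply: CkM; [exact: coord_smooth|exact: parint_smooth]. Qed.

Lemma derive_primitive_other f j p : j != i -> smooth f ->
  'D_(E j) (primitive f) p = primitive ('D_(E j) f) p.
Proof.
move=> ji sf; have [dp Dp] := parint_derive 0 sf p.
rewrite deriveM; last 2 first.
- exact/diff_derivable/smooth_differentiable/coord_smooth.
- exact: diff_derivable.
rewrite derive_coord Dp mxE eqxx eq_sym (negPf ji) scaler0 addr0.
rewrite (bigD1 j)//= big1 ?addr0 => [|l lj].
  by rewrite mxE !eqxx mul1r (negPf ji).
by rewrite mxE (negPf lj) mul0r.
Qed.

(* The derivative of [t * f (scale_coord t p)] is integrated over [0, 1]. *)
Lemma derive_primitive f p : smooth f -> 'D_(E i) (primitive f) p = f p.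
Proof.
move=> sf; have [dp Dp] := parint_derive 0 sf p.
rewrite deriveM; last 2 first.
- exact/diff_derivable/smooth_differentiable/coord_smooth.
- exact: diff_derivable.
rewrite derive_coord Dp mxE !eqxx (bigD1 i)//= big1 ?addr0 => [|l lj]; last first.
  by rewrite mxE (negPf lj) mul0r.
rewrite mxE !eqxx mul1r add0n [_ *: 1]mulr1.
change (p 0 i * parint 1 ('D_(E i) f) p + parint 0 f p = f p).
have c0 := parint_continuous (m := 0) (p := p) (smooth_continuous sf).
have c1 := parint_continuous (m := 1) (p := p) (smooth_continuous (smooth_derive (E i) sf)).
have cp : continuous (fun t => p 0 i * (t ^+ 1 * 'D_(E i) f (scale_coord t p))).
  by move=> t; exact: (continuousM (@cst_continuous R R (p 0 i) t) (c1 t)).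
have cS : continuous (fun t => t ^+ 0 * f (scale_coord t p)
    + p 0 i * (t ^+ 1 * 'D_(E i) f (scale_coord t p))).
  by move=> t; exact: (continuousD (c0 t) (cp t)).
rewrite /parint -int01Z// addrC -int01D//.
have dF t : is_derive t 1 (fun t => t * f (scale_coord t p))
    (t ^+ 0 * f (scale_coord t p) + p 0 i * (t ^+ 1 * 'D_(E i) f (scale_coord t p))).
  apply: (is_derive_eq (is_deriveM (is_derive_id t 1) (scale_coord_is_derive p t sf))).
  rewrite expr0 mul1r expr1 [_ *: 1]mulr1 addrC; congr (_ + _).
  exact: mulrCA.
by rewrite (int01_FTC cS dF) scale_coord1 mul1r mul0r subr0.
Qed.

End CoordinateScaling.

(** * Multivector fields over a differential ring *)

Section GradedAlgebra.
Variables (A : comNzRingType) (n : nat) (D : 'I_n -> A -> A).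
Implicit Types (u v : {set 'I_n} -> A) (S B : {set 'I_n}) (i : 'I_n).

(** This and the next three definitions are [wedge], [ldiff], [rdiff] and [schouten] with
    coefficients in an abstract ring instead of functions of a point, so that identities between
    coefficients become ring identities. *)
Definition mul_mv u v S : A :=
  \sum_(B : {set 'I_n} | B \subset S)
     (-1) ^+ ninv B (S :\: B) * (u B * v (S :\: B)).

Definition ldiff_mv i u S : A :=
  if i \in S then 0
  else (-1) ^+ #|[pred a in S | (a < i)%N]| * u (i |: S).

Definition rdiff_mv i u S : A :=
  if i \in S then 0
  else (-1) ^+ #|[pred a in S | (i < a)%N]| * u (i |: S).

Definition bracket_mv u v S : A :=
  \sum_(i < n) (mul_mv (rdiff_mv i u) (D i \o v) S
                - mul_mv (D i \o u) (ldiff_mv i v) S).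

End GradedAlgebra.

(** * Subsets of three indices as triples of booleans *)

Definition bset (a b c : bool) : {set 'I_3} :=
  finset (fun i : 'I_3 => nth false [:: a; b; c] i).

Section Bset.
Implicit Types (a b c : bool) (S : {set 'I_3}) (i : 'I_3).

Lemma ord3P (P : 'I_3 -> Prop) : P ix -> P iy -> P iz -> forall i, P i.
Proof.
move=> Px Py Pz [[|[|[|//]]] lt_i3].
- by rewrite (_ : Ordinal _ = ix)//; exact: val_inj.
- by rewrite (_ : Ordinal _ = iy)//; exact: val_inj.
- by rewrite (_ : Ordinal _ = iz)//; exact: val_inj.
Qed.

Lemma big_ord3 (T : Type) (idx : T) (op : Monoid.law idx) (F : 'I_3 -> T) :
  \big[op/idx]_(i < 3) F i = op (op (F ix) (F iy)) (F iz).
Proof.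
rewrite !big_ord_recr big_ord0 /= Monoid.mul1m.
by congr (op (op (F _) (F _)) (F _)); exact: val_inj.
Qed.

Lemma bset_memP S : S = bset (ix \in S) (iy \in S) (iz \in S).
Proof. by apply/setP; apply: ord3P; rewrite !inE. Qed.

Lemma bset_ind (P : {set 'I_3} -> Prop) : (forall a b c, P (bset a b c)) -> forall S, P S.
Proof. by move=> H S; rewrite (bset_memP S). Qed.

Lemma bset_inj a b c a' b' c' :
  (bset a b c == bset a' b' c') = [&& a == a', b == b' & c == c'].
Proof.
apply/eqP/and3P => [E|[/eqP-> /eqP-> /eqP->]//].
by split; apply/eqP; [have := congr1 (fun S => ix \in S) E
  |have := congr1 (fun S => iy \in S) E|have := congr1 (fun S => iz \in S) E];
  rewrite !inE.
Qed.

Lemma bset0 : finset.set0 = bset false false false.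
Proof. by apply/setP; apply: ord3P; rewrite !inE. Qed.

Lemma bset1x : finset.set1 ix = bset true false false.
Proof. by apply/setP; apply: ord3P; rewrite !inE. Qed.

Lemma bset1y : finset.set1 iy = bset false true false.
Proof. by apply/setP; apply: ord3P; rewrite !inE. Qed.

Lemma bset1z : finset.set1 iz = bset false false true.
Proof. by apply/setP; apply: ord3P; rewrite !inE. Qed.

Lemma in_bset a b c : ((ix \in bset a b c) = a) * ((iy \in bset a b c) = b)
  * ((iz \in bset a b c) = c).
Proof. by rewrite !inE. Qed.

Lemma bset_sub a b c a' b' c' :
  (bset a b c \subset bset a' b' c') = [&& a ==> a', b ==> b' & c ==> c'].
Proof.
apply/fintype.subsetP/and3P => [H|[ha hb hc]].
  by split; apply/implyP => h;
    [have := H ix|have := H iy|have := H iz]; rewrite !in_bset; apply.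
by apply: ord3P; rewrite !in_bset; apply/implyP.
Qed.

Lemma bsetD a b c a' b' c' : bset a b c :\: bset a' b' c'
  = bset (a && ~~ a') (b && ~~ b') (c && ~~ c').
Proof. by apply/setP; apply: ord3P; rewrite !inE /= andbC. Qed.

Lemma bset_setU1 a b c : (ix |: bset a b c = bset true b c)
  * (iy |: bset a b c = bset a true c) * (iz |: bset a b c = bset a b true).
Proof. by do ![split]; apply/setP; apply: ord3P; rewrite !inE. Qed.

Lemma card_bset_pred a b c (P : pred 'I_3) :
  #|[pred i in bset a b c | P i]| = ((a && P ix) + (b && P iy) + (c && P iz))%N.
Proof.
rewrite -sum1_card big_mkcond (@big_ord3 _ _ addn) !inE /=.
by do 3 case: (_ && _).
Qed.

Lemma card_bset a b c : #|bset a b c| = (a + b + c)%N.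
Proof.
rewrite -sum1_card big_mkcond (@big_ord3 _ _ addn) !inE /=.
by case: a; case: b; case: c.
Qed.

Lemma bset_ninv a b c a' b' c' : ninv (bset a b c) (bset a' b' c')
  = ((b && a') + ((c && a') + (c && b')))%N.
Proof.
rewrite /ninv big_mkcond (@big_ord3 _ _ addn) !card_bset_pred !in_bset /=.
by case: a; case: b; case: c; case: a'; case: b'; case: c'.
Qed.

Lemma sum_bset (A : nmodType) (P : pred {set 'I_3}) (F : {set 'I_3} -> A) :
  let G a b c := if P (bset a b c) then F (bset a b c) else 0 in
  \sum_(S | P S) F S = G true true true + G true true false
    + (G true false true + G true false false)
    + (G false true true + G false true false
       + (G false false true + G false false false)).
Proof.
move=> G; rewrite big_mkcond.
rewrite (reindex (fun t : bool * bool * bool => bset t.1.1 t.1.2 t.2)) /=.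
  rewrite -(pair_bigA _ (fun (t : bool * bool) c => G t.1 t.2 c)) /=.
  rewrite -(pair_bigA _ (fun a b => \sum_c G a b c)) /=.
  by rewrite !big_bool.
exists (fun S => ((ix \in S, iy \in S), iz \in S)) => [[[a b] c] _|S _] /=.
  by rewrite !in_bset.
by rewrite -bset_memP.
Qed.

Variables (A : comNzRingType).
Implicit Types (u v : {set 'I_3} -> A).

Definition sgn a : A := if a then -1 else 1.

Lemma sgnE (a : bool) : (-1) ^+ a = sgn a.
Proof. by case: a. Qed.

Lemma sgn_ninv a b c a' b' c' : (-1) ^+ ninv (bset a b c) (bset a' b' c')
  = sgn (b && a') * (sgn (c && a') * sgn (c && b')) :> A.
Proof. by rewrite bset_ninv !exprD !sgnE. Qed.

Lemma mul_mv_bset u v a b c :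
  let G a' b' c' := if [&& a' ==> a, b' ==> b & c' ==> c] then
      sgn (b' && (a && ~~ a')) * (sgn (c' && (a && ~~ a'))
        * sgn (c' && (b && ~~ b')))
      * (u (bset a' b' c') * v (bset (a && ~~ a') (b && ~~ b') (c && ~~ c')))
    else 0 in
  mul_mv u v (bset a b c) = G true true true + G true true false
    + (G true false true + G true false false)
    + (G false true true + G false true false
       + (G false false true + G false false false)).
Proof.
by move=> G; rewrite /mul_mv sum_bset !bset_sub !bsetD !sgn_ninv.
Qed.

Lemma ldiff_bset u a b c : (ldiff_mv ix u (bset a b c) = if a then 0 else u (bset true b c))
  * (ldiff_mv iy u (bset a b c) = if b then 0 else sgn a * u (bset a true c))
  * (ldiff_mv iz u (bset a b c) =
      if c then 0 else sgn a * sgn b * u (bset a b true)).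
Proof.
rewrite /ldiff_mv !card_bset_pred !in_bset !bset_setU1 /= !andbF !andbT !addn0 exprD !sgnE.
by rewrite mul1r.
Qed.

Lemma rdiff_bset u a b c :
  (rdiff_mv ix u (bset a b c) = if a then 0 else sgn b * sgn c * u (bset true b c))
  * (rdiff_mv iy u (bset a b c) = if b then 0 else sgn c * u (bset a true c))
  * (rdiff_mv iz u (bset a b c) = if c then 0 else u (bset a b true)).
Proof.
rewrite /rdiff_mv !card_bset_pred !in_bset !bset_setU1 /= !andbF !andbT !add0n exprD !sgnE.
by rewrite mul1r.
Qed.

End Bset.

(** * The Heisenberg differential in components *)

Local Notation c0 u := (u (bset false false false)).
Local Notation c1 u := (u (bset true false false)).
Local Notation c2 u := (u (bset false true false)).
Local Notation c3 u := (u (bset false false true)).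
Local Notation c12 u := (u (bset true true false)).
Local Notation c13 u := (u (bset true false true)).
Local Notation c23 u := (u (bset false true true)).
Local Notation c123 u := (u (bset true true true)).

Section HeisenbergComplex.
Variables (A : comNzRingType) (D : 'I_3 -> A -> A) (z : A).
Hypotheses (DD : forall i f g, D i (f + g) = D i f + D i g)
  (DM : forall i f g, D i (f * g) = D i f * g + f * D i g)
  (DC : forall i j f, D i (D j f) = D j (D i f))
  (Dxz : D ix z = 0) (Dyz : D iy z = 0) (Dzz : D iz z = 1).
Implicit Types (u v : {set 'I_3} -> A).

Lemma derivation0 i : D i 0 = 0.
Proof. by apply: (@addrI _ (D i 0)); rewrite -DD !addr0. Qed.

Lemma derivationN i f : D i (- f) = - D i f.
Proof. by apply/eqP; rewrite -subr_eq0 opprK -DD addNr derivation0. Qed.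

Lemma derivation1 i : D i 1 = 0.
Proof.
apply: (@addrI _ (D i 1)); rewrite addr0 -[in RHS](mulr1 1) DM.
by rewrite mulr1 mul1r.
Qed.

Definition heis_mv (S : {set 'I_3}) : A := if S == bset true true false then z else 0.

Definition dheis v := bracket_mv D heis_mv v.

Lemma heis_bset a b c : heis_mv (bset a b c) = if [&& a, b & ~~ c] then z else 0.
Proof. by rewrite /heis_mv bset_inj !eqb_id eqbF_neg. Qed.

(** The sums over subsets are expanded once and for all, for inhomogeneous fields; the identities
    below then rewrite with explicit bilinear expressions. *)
Lemma bracket_mvE u v :
  [/\ c0 (bracket_mv D u v) =
       c1 u * D ix (c0 v) - D ix (c0 u) * c1 v + c2 u * D iy (c0 v) - D iy (c0 u) * c2 v
        + c3 u * D iz (c0 v) - D iz (c0 u) * c3 v,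
      c1 (bracket_mv D u v) =
       c1 u * D ix (c1 v) - D ix (c1 u) * c1 v + c2 u * D iy (c1 v) + D iy (c0 u) * c12 v
        + c12 u * D iy (c0 v) - D iy (c1 u) * c2 v + c3 u * D iz (c1 v) + D iz (c0 u) * c13 v
        + c13 u * D iz (c0 v) - D iz (c1 u) * c3 v,
      c2 (bracket_mv D u v) =
       c1 u * D ix (c2 v) - D ix (c0 u) * c12 v - c12 u * D ix (c0 v) - D ix (c2 u) * c1 v
        + c2 u * D iy (c2 v) - D iy (c2 u) * c2 v + c3 u * D iz (c2 v) + D iz (c0 u) * c23 v
        + c23 u * D iz (c0 v) - D iz (c2 u) * c3 v &
      c3 (bracket_mv D u v) =
       c1 u * D ix (c3 v) - D ix (c0 u) * c13 v - c13 u * D ix (c0 v) - D ix (c3 u) * c1 v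
        + c2 u * D iy (c3 v) - D iy (c0 u) * c23 v - c23 u * D iy (c0 v) - D iy (c3 u) * c2 v
        + c3 u * D iz (c3 v) - D iz (c3 u) * c3 v] /\
  [/\ c12 (bracket_mv D u v) =
       c1 u * D ix (c12 v) + c12 u * D ix (c1 v) - D ix (c1 u) * c12 v - D ix (c12 u) * c1 v
        + c2 u * D iy (c12 v) - D iy (c2 u) * c12 v + c12 u * D iy (c2 v) - D iy (c12 u) * c2 v
        + c3 u * D iz (c12 v) - D iz (c0 u) * c123 v - c23 u * D iz (c1 v) - D iz (c2 u) * c13 v
        + c13 u * D iz (c2 v) + D iz (c1 u) * c23 v + c123 u * D iz (c0 v) - D iz (c12 u) * c3 v,
      c13 (bracket_mv D u v) =
       c1 u * D ix (c13 v) + c13 u * D ix (c1 v) - D ix (c1 u) * c13 v - D ix (c13 u) * c1 v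
        + c2 u * D iy (c13 v) + D iy (c0 u) * c123 v + c23 u * D iy (c1 v) - D iy (c3 u) * c12 v
        + c12 u * D iy (c3 v) - D iy (c1 u) * c23 v - c123 u * D iy (c0 v) - D iy (c13 u) * c2 v
        + c3 u * D iz (c13 v) - D iz (c3 u) * c13 v + c13 u * D iz (c3 v) - D iz (c13 u) * c3 v,
      c23 (bracket_mv D u v) =
       c1 u * D ix (c23 v) - D ix (c0 u) * c123 v + c13 u * D ix (c2 v) + D ix (c3 u) * c12 v
        - c12 u * D ix (c3 v) - D ix (c2 u) * c13 v + c123 u * D ix (c0 v) - D ix (c23 u) * c1 v
        + c2 u * D iy (c23 v) + c23 u * D iy (c2 v) - D iy (c2 u) * c23 v - D iy (c23 u) * c2 v
        + c3 u * D iz (c23 v) - D iz (c3 u) * c23 v + c23 u * D iz (c3 v) - D iz (c23 u) * c3 v &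
      c123 (bracket_mv D u v) =
       c1 u * D ix (c123 v) - c13 u * D ix (c12 v) + c12 u * D ix (c13 v) + c123 u * D ix (c1 v)
        - D ix (c1 u) * c123 v + D ix (c13 u) * c12 v - D ix (c12 u) * c13 v - D ix (c123 u) * c1 v
        + c2 u * D iy (c123 v) - c23 u * D iy (c12 v) - D iy (c2 u) * c123 v + D iy (c23 u) * c12 v
        + c12 u * D iy (c23 v) + c123 u * D iy (c2 v) - D iy (c12 u) * c23 v - D iy (c123 u) * c2 v
        + c3 u * D iz (c123 v) - D iz (c3 u) * c123 v - c23 u * D iz (c13 v) + D iz (c23 u) * c13 v
        + c13 u * D iz (c23 v) - D iz (c13 u) * c23 v + c123 u * D iz (c3 v) - D iz (c123 u) * c3 v].
Proof.
rewrite /bracket_mv; split; split; rewrite (@big_ord3 _ _ +%R) !mul_mv_bset /=;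
 rewrite !rdiff_bset !ldiff_bset /sgn /=; ring.
Qed.

Lemma dheisE v :
  [/\ c0 (dheis v) = 0, c1 (dheis v) = z * D iy (c0 v),
      c2 (dheis v) = - (z * D ix (c0 v)) & c3 (dheis v) = 0] /\
  [/\ c12 (dheis v) = z * (D ix (c1 v) + D iy (c2 v)) - c3 v,
      c13 (dheis v) = z * D iy (c3 v), c23 (dheis v) = - (z * D ix (c3 v)) &
      c123 (dheis v) = z * (D ix (c13 v) + D iy (c23 v))].
Proof.
have [[b0 b1 b2 b3] [b12 b13 b23 b123]] := bracket_mvE heis_mv v.
rewrite /dheis b0 b1 b2 b3 b12 b13 b23 b123 !heis_bset /= Dxz Dyz Dzz !derivation0.
by split; split; ring.
Qed.

(* Carrying the sign (-1)^p of a factor of degree p by this involution makes the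
   graded identities below hold for inhomogeneous fields. *)
Definition parity_mv u (S : {set 'I_3}) : A := (-1) ^+ #|S| * u S.

Lemma parity_bset u a b c : parity_mv u (bset a b c) = sgn A (a (+) b (+) c) * u (bset a b c).
Proof.
rewrite /parity_mv card_bset; case: a; case: b; case: c;
  by rewrite /= ?expr0 ?expr1 ?sqrrN ?expr1n//; congr (_ * _); rewrite /sgn; ring.
Qed.

Lemma dheis_mul u v S : dheis (mul_mv u v) S
  = mul_mv (dheis u) v S + mul_mv (parity_mv u) (dheis v) S.
Proof.
have [[u0 u1 u2 u3] [u12 u13 u23 u123]] := dheisE u.
have [[v0 v1 v2 v3] [v12 v13 v23 v123]] := dheisE v.
have [[w0 w1 w2 w3] [w12 w13 w23 w123]] := dheisE (mul_mv u v).
move: S; apply: bset_ind => [] [] [] [];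
rewrite ?(w0, w1, w2, w3, w12, w13, w23, w123) !mul_mv_bset /= !parity_bset /=
  ?(u0, u1, u2, u3, u12, u13, u23, u123) ?(v0, v1, v2, v3, v12, v13, v23, v123);
rewrite /sgn ?(mul1r, mulNr, addr0, add0r) ?(derivationN, DD, DM, Dxz, Dyz, derivation0); ring.
Qed.

(** The graded Jacobi identity for [heis_mv], u and v. The second term carries the sign (-1)^(p-1)
    for u of degree p, hence the minus in front of [parity_mv u]. *)
Lemma dheis_bracket u v S : dheis (bracket_mv D u v) S
  = bracket_mv D (dheis u) v S - bracket_mv D (parity_mv u) (dheis v) S.
Proof.
have [[w0 w1 w2 w3] [w12 w13 w23 w123]] := dheisE (bracket_mv D u v).
have [[b0 b1 b2 b3] [b12 b13 b23 b123]] := bracket_mvE u v.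
have [[d0 d1 d2 d3] [d12 d13 d23 d123]] := bracket_mvE (dheis u) v.
have [[e0 e1 e2 e3] [e12 e13 e23 e123]] := bracket_mvE (parity_mv u) (dheis v).
have [[u0 u1 u2 u3] [u12 u13 u23 u123]] := dheisE u.
have [[v0 v1 v2 v3] [v12 v13 v23 v123]] := dheisE v.
move: S; apply: bset_ind => [] [] [] [].
(* A component of [dheis] involves few coefficients of the bracket; only those are expanded, to keep
   the eight goals small. *)
1: rewrite w123 d123 e123 b13 b23.
2: rewrite w12 d12 e12 b1 b2 b3.
3: rewrite w13 d13 e13 b3.
4: rewrite w1 d1 e1 b0.
5: rewrite w23 d23 e23 b3.
6: rewrite w2 d2 e2 b0.
7: rewrite w3 d3 e3.
8: rewrite w0 d0 e0.
all: rewrite ?(u0, u1, u2, u3, u12, u13, u23, u123) ?(v0, v1, v2, v3, v12, v13, v23, v123).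
all: rewrite !parity_bset /= /sgn.
all: clear - DD DM DC Dxz Dyz Dzz.
all: move: (c0 u) (c1 u) (c2 u) (c3 u) (c12 u) (c13 u) (c23 u) (c123 u)
  => u0 u1 u2 u3 u12 u13 u23 u123.
all: move: (c0 v) (c1 v) (c2 v) (c3 v) (c12 v) (c13 v) (c23 v) (c123 v)
  => v0 v1 v2 v3 v12 v13 v23 v123.
all: rewrite !mul1r !mulN1r.
all: rewrite ?(DD, DM, derivationN, derivation0, Dxz, Dyz, Dzz).
(* Mixed derivatives are put in one order, so that [ring] sees equal ones as the same atom. *)
all: rewrite ?(DC iy ix) ?(DC iz ix) ?(DC iz iy).
all: move: (D ix) (D iy) (D iz) => D1 D2 D3.
8: ring.
7: ring.
6: ring.
5: ring.
4: ring.
3: ring.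
2: ring.
1: ring.
Qed.

End HeisenbergComplex.

(** * The ring of smooth functions *)

Section SmoothRing.
Variables (R : realType) (n : nat).
Notation V := 'rV[R]_n.

Definition smooth_pred : {pred (V -> R)} := fun f => `[< smooth f >].

Fact smooth_subring : subring_closed smooth_pred.
Proof.
split=> [|f g|f g]; rewrite !unfold_in /=.
- by apply/asboolP => k; exact: Ck_cst.
- move=> /asboolP sf /asboolP sg; apply/asboolP => k.
  apply: CkD; first exact: sf.
  rewrite -mulN1r; apply: CkM; last exact: sg.
  exact: (Ck_cst _ k (-1)).
- by move=> /asboolP sf /asboolP sg; apply/asboolP => k; apply: CkM.
Qed.

HB.instance Definition _ :=
  GRing.isSubringClosed.Build (V -> R) smooth_pred smooth_subring.

(** A type for the subring of smooth functions: smoothness travels with the coefficients, and the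
    algebra over abstract rings applies to them. *)
Record smf := Smf { smf_fun :> V -> R; smf_in : smf_fun \in smooth_pred }.

HB.instance Definition _ := [isSub for smf_fun].
HB.instance Definition _ := [Choice of smf by <:].
HB.instance Definition _ := [SubChoice_isSubComNzRing of smf by <:].

Implicit Types (f g : smf).

Lemma smf_smooth f : smooth f.
Proof. by apply/asboolP; have := smf_in f; rewrite unfold_in. Qed.

Definition to_smf (h : V -> R) (sh : smooth h) : smf := Smf (asboolT sh : h \in smooth_pred).

Lemma smfP f g : f =1 g -> f = g.
Proof. by move=> fg; apply: val_inj; apply/funext. Qed.

Lemma smf0 p : (0 : smf) p = 0. Proof. by []. Qed.
Lemma smfD f g p : (f + g) p = f p + g p. Proof. by []. Qed.
Lemma smfN f p : (- f) p = - f p. Proof. by []. Qed.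
Lemma smfM f g p : (f * g) p = f p * g p. Proof. by []. Qed.
Lemma smf_sum (I : Type) (r : seq I) (P : pred I) (F : I -> smf) p :
  (\sum_(i <- r | P i) F i) p = \sum_(i <- r | P i) F i p.
Proof. by apply: (big_morph (fun f : smf => f p)). Qed.
Lemma smf_sign k f p : ((-1) ^+ k * f) p = (-1) ^+ k * f p.
Proof. by elim: k => [|k IH]; rewrite ?expr0 ?mul1r// !exprS -!mulrA !mulN1r smfN IH. Qed.

Definition smf_der (i : 'I_n) f : smf := to_smf (smooth_derive (delta_mx 0 i) (smf_smooth f)).

Lemma smf_derE i f p : smf_der i f p = pder i f p. Proof. by []. Qed.

Lemma smf_derD i f g : smf_der i (f + g) = smf_der i f + smf_der i g.
Proof.
apply: smfP => p; rewrite smfD !smf_derE /pder.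
by rewrite (deriveD (f := f) (g := g))//; apply/diff_derivable/smooth_differentiable/smf_smooth.
Qed.

Lemma smf_derM i f g : smf_der i (f * g) = smf_der i f * g + f * smf_der i g.
Proof.
apply: smfP => p; rewrite smfD !smfM !smf_derE /pder.
rewrite (deriveM (f := f) (g := g)); last 2 first.
- exact/diff_derivable/smooth_differentiable/smf_smooth.
- exact/diff_derivable/smooth_differentiable/smf_smooth.
by rewrite addrC [X in X + _]mulrC.
Qed.

Lemma smf_derC i j f : smf_der i (smf_der j f) = smf_der j (smf_der i f).
Proof. by apply: smfP => p; rewrite !smf_derE; exact/derive_comm/smf_smooth. Qed.

Definition smf_coord (i : 'I_n) : smf := to_smf (@coord_smooth R n i).

Lemma smf_der_coord i j : smf_der i (smf_coord j) = (i == j)%:R.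
Proof.
apply: smfP => p; rewrite smf_derE /pder [LHS]derive_coord mxE eqxx eq_sym /=.
by case: (i == j).
Qed.

Definition emb (u : {set 'I_n} -> smf) : mvf R n := fun S => smf_fun (u S).

Lemma emb_inj : injective emb.
Proof. by move=> u v uv; apply/funext => S; apply: smfP => p; rewrite -/(emb u S p) uv. Qed.

Lemma embP (P : mvf R n) : (forall S, smooth (P S)) -> exists u, P = emb u.
Proof. by move=> sP; exists (fun S => to_smf (sP S)). Qed.

Lemma emb0 : emb 0 = 0. Proof. by []. Qed.
Lemma embD u v : emb (u + v) = emb u + emb v. Proof. by []. Qed.
Lemma embB u v : emb (u - v) = emb u - emb v. Proof. by []. Qed.

Lemma emb_mul u v : emb (mul_mv u v) = wedge (emb u) (emb v).
Proof.
apply/funext => S; apply/funext => p; rewrite /emb /wedge /mul_mv smf_sum.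
by apply: eq_bigr => B _; rewrite smf_sign.
Qed.

Lemma emb_ldiff i u : emb (ldiff_mv i u) = ldiff i (emb u).
Proof.
apply/funext => S; apply/funext => p; rewrite /emb /ldiff /ldiff_mv.
by case: ifP => // _; rewrite smf_sign.
Qed.

Lemma emb_rdiff i u : emb (rdiff_mv i u) = rdiff i (emb u).
Proof.
apply/funext => S; apply/funext => p; rewrite /emb /rdiff /rdiff_mv.
by case: ifP => // _; rewrite smf_sign.
Qed.

Lemma emb_bracket u v : emb (bracket_mv smf_der u v) = schouten (emb u) (emb v).
Proof.
apply/funext => S; apply/funext => p; rewrite /schouten /emb /bracket_mv smf_sum.
have E (a b : {set 'I_n} -> smf) : smf_fun (mul_mv a b S) p = wedge (emb a) (emb b) S p
  by rewrite -emb_mul.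
by apply: eq_bigr => i _; rewrite smfD smfN !E emb_rdiff emb_ldiff.
Qed.

End SmoothRing.

(** * Degrees and bilinearity *)

Section Degree.
Variables (A : comNzRingType) (n : nat) (D : 'I_n -> A -> A).
Hypothesis DB : forall i f g, D i (f - g) = D i f - D i g.
Implicit Types (p q : nat) (u v : {set 'I_n} -> A) (S B : {set 'I_n}) (i : 'I_n).

Let D0 i : D i 0 = 0. Proof. by have := DB i 0 0; rewrite !subrr. Qed.

Definition homog (p : nat) u := forall S, #|S| != p -> u S = 0.

Lemma mul_mv_eq0 u v S :
  (forall B, B \subset S -> u B = 0 \/ v (S :\: B) = 0) -> mul_mv u v S = 0.
Proof.
by move=> uv0; apply: big1 => B /uv0[->|->]; rewrite ?mul0r !mulr0.
Qed.

Lemma card_subD B S : B \subset S -> (#|B| + #|S :\: B| = #|S|)%N.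
Proof. by move=> BS; rewrite -(cardsID B S) (finset.setIidPr BS). Qed.

Lemma mul_mv_homog p q u v : homog p u -> homog q v -> homog (p + q) (mul_mv u v).
Proof.
move=> hu hv S Spq; apply: mul_mv_eq0 => B BS.
have [Bp|/hu ->] := eqVneq #|B| p; last by left.
right; apply: hv; apply: contraNneq Spq => Eq.
by rewrite -Bp -Eq card_subD.
Qed.

Lemma ldiff_mv_homog p i u S : homog p u -> #|S|.+1 != p -> ldiff_mv i u S = 0.
Proof.
move=> hu Sp; rewrite /ldiff_mv; case: ifPn => // iS.
by rewrite hu ?mulr0// cardsU1 iS.
Qed.

Lemma rdiff_mv_homog p i u S : homog p u -> #|S|.+1 != p -> rdiff_mv i u S = 0.
Proof.
move=> hu Sp; rewrite /rdiff_mv; case: ifPn => // iS.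
by rewrite hu ?mulr0// cardsU1 iS.
Qed.

(** Comparing #|S| + 1 with p + q avoids truncated subtraction; for p = q = 0 this yields the
    vanishing of the bracket on every S. *)
Lemma bracket_mv_homogS p q u v S : homog p u -> homog q v ->
  #|S|.+1 != (p + q)%N -> bracket_mv D u v S = 0.
Proof.
move=> hu hv Spq; apply: big1 => i _.
rewrite !mul_mv_eq0 ?subrr// => B BS; rewrite /=.
- have [Bp|Bp] := eqVneq #|B| p; last by left; rewrite hu.
  right; apply: (ldiff_mv_homog _ hv); apply: contraNneq Spq => <-.
  by rewrite -(card_subD BS) Bp addnS.
- have [Bp|Bp] := eqVneq #|B|.+1 p; last by left; exact: (rdiff_mv_homog _ hu).
  right; rewrite hv ?D0//; apply: contraNneq Spq => <-.
  by rewrite -(card_subD BS) -Bp addSn.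
Qed.

Lemma bracket_mv_homog p q u v : homog p u -> homog q v ->
  homog (p + q).-1 (bracket_mv D u v).
Proof.
move=> hu hv S Spq; apply: (bracket_mv_homogS hu hv).
by apply: contraNneq Spq => <-.
Qed.

Lemma mul_mvBl u u' v S : mul_mv (u - u') v S = mul_mv u v S - mul_mv u' v S.
Proof. by rewrite -sumrB; apply: eq_bigr => B _; rewrite /= mulrBl mulrBr. Qed.

Lemma mul_mvBr u v v' S : mul_mv u (v - v') S = mul_mv u v S - mul_mv u v' S.
Proof. by rewrite -sumrB; apply: eq_bigr => B _; rewrite /= !mulrBr. Qed.

Lemma ldiff_mvB i u v : ldiff_mv i (u - v) = ldiff_mv i u - ldiff_mv i v.
Proof.
apply/funext => S; rewrite /ldiff_mv !fctE.
by case: ifP => _; rewrite ?subr0// mulrBr.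
Qed.

Lemma rdiff_mvB i u v : rdiff_mv i (u - v) = rdiff_mv i u - rdiff_mv i v.
Proof.
apply/funext => S; rewrite /rdiff_mv !fctE.
by case: ifP => _; rewrite ?subr0// mulrBr.
Qed.

Lemma der_mvB i u v : D i \o (u - v) = (D i \o u) - (D i \o v).
Proof. by apply/funext => S /=; rewrite !fctE DB. Qed.

Lemma bracket_mvBl u u' v S :
  bracket_mv D (u - u') v S = bracket_mv D u v S - bracket_mv D u' v S.
Proof.
rewrite -sumrB; apply: eq_bigr => i _.
rewrite rdiff_mvB der_mvB !mul_mvBl; ring.
Qed.

Lemma bracket_mvBr u v v' S :
  bracket_mv D u (v - v') S = bracket_mv D u v S - bracket_mv D u v' S.
Proof.
rewrite -sumrB; apply: eq_bigr => i _.
rewrite ldiff_mvB der_mvB !mul_mvBr; ring.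
Qed.

End Degree.

(** * Smooth functions of three variables *)

Section SmoothR3.
Variable R : realType.
Notation A := (smf R 3).
Notation D := (@smf_der R 3).
Implicit Types (h k : A) (p : 'rV[R]_3).

Definition zA : A := smf_coord R iz.
Definition xA : A := smf_coord R ix.
Definition yA : A := smf_coord R iy.

Lemma at_z0E (h : 'rV[R]_3 -> R) : at_z0 h = h \o scale_coord iz 0.
Proof.
apply/funext => p; rewrite /at_z0 /=; congr h; apply/rowP => j.
rewrite !mxE eqxx /= sub0r mulN1r eq_sym; case: eqP => [->|_].
  by rewrite mulr1 subrr.
by rewrite mulr0 addr0.
Qed.

Lemma at_z0_smooth (h : 'rV[R]_3 -> R) : smooth h -> smooth (at_z0 h).
Proof.
rewrite at_z0E => sh; apply: smooth_comp_linear => //.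
  exact: scale_coord_linear.
exact: scale_coord_continuous.
Qed.

Definition smf_at_z0 h : A := to_smf (at_z0_smooth (smf_smooth h)).

Lemma at0D h k : smf_at_z0 (h + k) = smf_at_z0 h + smf_at_z0 k. Proof. exact: smfP. Qed.
Lemma at0N h : smf_at_z0 (- h) = - smf_at_z0 h. Proof. exact: smfP. Qed.
Lemma at0M h k : smf_at_z0 (h * k) = smf_at_z0 h * smf_at_z0 k. Proof. exact: smfP. Qed.
Lemma at0_z : smf_at_z0 zA = 0.
Proof. by apply: smfP => p; rewrite /smf_at_z0 /at_z0 /= mxE. Qed.

Lemma der_at0 i h : D i (smf_at_z0 h) = if i == iz then 0 else smf_at_z0 (D i h).
Proof.
have linL := @scale_coord_linear R 3 iz 0.
have contL : continuous (@scale_coord R 3 iz 0) by exact: scale_coord_continuous.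
apply: smfP => p; rewrite smf_derE /pder /= at_z0E.
rewrite (derive_comp_linear linL contL) => [|q]; last exact/smooth_differentiable/smf_smooth.
rewrite scale_coord_delta deriveE ?linearZ -?deriveE; try exact/smooth_differentiable/smf_smooth.
case: eqP => _ /=; first by rewrite expr1 scale0r.
by rewrite expr0 scale1r at_z0E.
Qed.

Lemma hadamard_z h : exists k, h = smf_at_z0 h + zA * k.
Proof.
exists (to_smf (parint_smooth iz 0 (smooth_derive (delta_mx 0 iz) (smf_smooth h)))).
apply: smfP => p; rewrite smfD smfM /= parint_hadamard; last exact: smf_smooth.
by rewrite at_z0E /= addrC subrK.
Qed.

(** Away from the plane z = 0 the value of h is 0, and this set is dense, so continuity finishes.
    This is how factors z are cancelled in the components of the differential. *)
Lemma zA_reg h : zA * h = 0 -> h = 0.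
Proof.
move=> zh; have hp p : p 0 iz != 0 -> h p = 0.
  move=> pz; have /(congr1 (fun f : A => f p)) := zh; rewrite smfM smf0 => /eqP.
  by rewrite mulf_eq0 [smf_fun zA p]/(p 0 iz) (negPf pz) => /eqP.
apply: smfP => p; rewrite smf0; have [pz|/hp//] := eqVneq (p 0 iz) 0.
apply/eqP; rewrite -normr_le0; apply/ler_addgt0Pr => e e0; rewrite add0r.
have /cvgrPdist_lt/(_ _ e0) := smooth_continuous (smf_smooth h) (x := p).
move=> /nbhs_ballP[d /= d0 Hd].
pose q : 'rV[R]_3 := p + (d / 2) *: delta_mx 0 iz.
have d20 : 0 < d / 2 by rewrite divr_gt0.
have qz : q 0 iz != 0 by rewrite !mxE !eqxx /= pz add0r mulr1 gt_eqF.
have /= := Hd q; rewrite (hp _ qz) subr0 => H; apply/ltW/H.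
rewrite -ball_normE /= opprD addNKr normrN normrZ gtr0_norm//.
apply: (@le_lt_trans _ _ (d / 2 * 1)).
  apply: ler_wpM2l; first exact: ltW.
  rewrite [leLHS]/Num.norm/= mx_normrE.
  apply/bigmax_leP; split=> // -[i j] _ /=; rewrite mxE.
  by case: (_ && _); rewrite ?normr1 ?normr0.
by rewrite mulr1 ltr_pdivrMr// mulr2n mulrDr mulr1 ltrDl.
Qed.

Definition smf_primitive i h : A := to_smf (primitive_smooth i (smf_smooth h)).

Lemma der_prim i h : D i (smf_primitive i h) = h.
Proof. by apply: smfP => p; exact/derive_primitive/smf_smooth. Qed.

Lemma prim0 i : smf_primitive i 0 = 0.
Proof.
apply: smfP => p; rewrite /= /primitive /parint.
have c0 : continuous ((fun=> 0) : R -> R) by exact: cst_continuous.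
rewrite (_ : (fun t => _) = fun t => 0 * (fun=> 0) t); first by rewrite int01Z// mul0r mulr0.
by apply/funext => t; rewrite mulr0 mul0r.
Qed.

Lemma der_prim_other i j h : j != i -> D j h = 0 -> D j (smf_primitive i h) = 0.
Proof.
move=> ji Djh; rewrite -(prim0 i) -Djh; apply: smfP => p.
exact: (derive_primitive_other p ji (smf_smooth h)).
Qed.

(** Poincare lemma in (x, y) with z as parameter. A y-primitive k1 of a has the right y-derivative;
    the defect m = b + D_x k1 is independent of y by the hypothesis, so subtracting its x-primitive
    repairs the x-derivative and leaves the y-derivative alone. *)
Lemma divergence_free_xy a b : D ix a + D iy b = 0 ->
  exists k, D iy k = a /\ D ix k = - b.
Proof.
move=> ab0; pose k1 := smf_primitive iy a; pose m := b + D ix k1.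
have Dm : D iy m = 0.
  by rewrite smf_derD smf_derC der_prim addrC.
exists (k1 - smf_primitive ix m).
have DN i f : D i (- f) = - D i f := derivationN (@smf_derD R 3) i f.
rewrite !smf_derD !DN !der_prim (der_prim_other _ Dm)// subr0; split=> //.
by rewrite /m opprD addrCA subrr addr0.
Qed.

Lemma of_z_smooth (f : R -> R) : smooth f -> smooth (of_z f).
Proof.
move=> sf; apply: (smooth_comp_linear _ _ sf).
  by move=> a u v; rewrite /zc !mxE.
exact: coord_continuous.
Qed.

Lemma of_xy_smooth (g : R * R -> R) : smooth g -> smooth (of_xy g).
Proof.
move=> sg; apply: (@smooth_comp_linear _ _ _ (fun p => (xc p, yc p)) _ _ _ sg).
  by move=> a u v; rewrite /xc /yc !mxE.
move=> p; apply: (@cvg_pair _ _ _ (nbhs p) (nbhs (xc p)) (nbhs (yc p)) _ _ _ (@xc R) (@yc R));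
  exact: coord_continuous.
Qed.

Definition smf_of_z f (sf : smooth f) : A := to_smf (of_z_smooth sf).
Definition smf_of_xy g (sg : smooth g) : A := to_smf (of_xy_smooth sg).

Lemma der_fz f (sf : smooth f) i : i != iz -> D i (smf_of_z sf) = 0.
Proof.
move=> iz0; apply: smfP => p; rewrite smf_derE /pder /=.
have linL : linear (@zc R) by move=> a u v; rewrite /zc !mxE.
have contL : continuous (@zc R) by exact: coord_continuous.
rewrite [LHS](derive_comp_linear linL contL) => [|q]; last exact: smooth_differentiable.
by rewrite /zc mxE eqxx eq_sym (negPf iz0) derive0.
Qed.

Lemma at0_fxy g (sg : smooth g) : smf_at_z0 (smf_of_xy sg) = smf_of_xy sg.
Proof.
apply: smfP => p; rewrite /= /at_z0 /of_xy /xc /yc !mxE.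
by congr (g (_, _)).
Qed.

Lemma at0_fxyE h : exists (g : R * R -> R) (sg : smooth g), smf_at_z0 h = smf_of_xy sg.
Proof.
pose L (q : R * R) : 'rV[R]_3 := q.1 *: delta_mx 0 ix + q.2 *: delta_mx 0 iy.
have sg : smooth (smf_fun h \o L).
  apply: smooth_comp_linear; last exact: smf_smooth.
    move=> a u v; rewrite /L /= scalerDr !scalerA !scalerDl addrACA.
    by rewrite -!scalerA.
  move=> q; apply: cvgD.
    apply: (@continuous_comp _ _ _ (fun q : R * R => q.1) (fun s : R => s *: delta_mx 0 ix)).
      exact: cvg_fst.
    exact: scalel_continuous.
  apply: (@continuous_comp _ _ _ (fun q : R * R => q.2) (fun s : R => s *: delta_mx 0 iy)).
    exact: cvg_snd.
  exact: scalel_continuous.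
exists _, sg; apply: smfP => p; rewrite /= /at_z0 /of_xy /L /=.
congr (smf_fun h _); apply/rowP; apply: ord3P; rewrite !mxE /= /xc /yc;
  by rewrite !(mulr1, mulr0, addr0, add0r).
Qed.

(** Such an h is constant along lines in the x and y directions, hence equals its restriction to the
    z-axis. *)
Lemma der_eq0_fz h : D ix h = 0 -> D iy h = 0 ->
  exists (f : R -> R) (sf : smooth f), h = smf_of_z sf.
Proof.
move=> Dx Dy; pose L (t : R) : 'rV[R]_3 := t *: delta_mx 0 iz.
have sf : smooth (smf_fun h \o L).
  apply: smooth_comp_linear; last exact: smf_smooth.
    by move=> a u v; rewrite /L scalerDl scalerA.
  exact: scalel_continuous.
have dh q : differentiable h q by exact/smooth_differentiable/smf_smooth.
have D0 i : D i h = 0 -> forall q t, h (q + t *: delta_mx 0 i) = h q.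
  move=> Di; apply: derive_eq0_line => // q.
  exact: (congr1 (fun f : A => f q) Di).
exists _, sf; apply: smfP => p; rewrite /= /of_z /L /=.
rewrite -[RHS](D0 _ Dx _ (p 0 ix)) -[RHS](D0 _ Dy _ (p 0 iy)); congr (smf_fun h _).
by apply/rowP; apply: ord3P; rewrite !mxE /= /zc;
  by rewrite !(mulr1, mulr0, addr0, add0r).
Qed.

End SmoothR3.

(** * The Heisenberg complex *)

Section Components.
Variable A : comNzRingType.
Implicit Types (u v : {set 'I_3} -> A).

Definition mvec (a0 a1 a2 a3 a12 a13 a23 a123 : A) (S : {set 'I_3}) : A :=
  if ix \in S then
    if iy \in S then if iz \in S then a123 else a12 else if iz \in S then a13 else a1
  else
    if iy \in S then if iz \in S then a23 else a2 else if iz \in S then a3 else a0.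

Lemma mvec_bset a0 a1 a2 a3 a12 a13 a23 a123 a b c :
  mvec a0 a1 a2 a3 a12 a13 a23 a123 (bset a b c) =
  if a then if b then if c then a123 else a12 else if c then a13 else a1
  else if b then if c then a23 else a2 else if c then a3 else a0.
Proof. by rewrite /mvec !in_bset. Qed.

Lemma mvecE u : u = mvec (c0 u) (c1 u) (c2 u) (c3 u) (c12 u) (c13 u) (c23 u) (c123 u).
Proof. by apply/funext; apply: bset_ind => [] [] [] []; rewrite mvec_bset. Qed.

Lemma mvecD a0 a1 a2 a3 a12 a13 a23 a123 b0 b1 b2 b3 b12 b13 b23 b123 :
  mvec a0 a1 a2 a3 a12 a13 a23 a123 + mvec b0 b1 b2 b3 b12 b13 b23 b123 =
  mvec (a0 + b0) (a1 + b1) (a2 + b2) (a3 + b3) (a12 + b12) (a13 + b13) (a23 + b23)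
     (a123 + b123).
Proof. by apply/funext; apply: bset_ind => [] [] [] []; rewrite fctE !mvec_bset. Qed.

Lemma mvecB a0 a1 a2 a3 a12 a13 a23 a123 b0 b1 b2 b3 b12 b13 b23 b123 :
  mvec a0 a1 a2 a3 a12 a13 a23 a123 - mvec b0 b1 b2 b3 b12 b13 b23 b123 =
  mvec (a0 - b0) (a1 - b1) (a2 - b2) (a3 - b3) (a12 - b12) (a13 - b13) (a23 - b23)
     (a123 - b123).
Proof. by apply/funext; apply: bset_ind => [] [] [] []; rewrite !fctE !mvec_bset. Qed.

Lemma mvec0 : mvec 0 0 0 0 0 0 0 0 = 0.
Proof. by apply/funext; apply: bset_ind => [] [] [] []; rewrite mvec_bset. Qed.

Lemma mvec_inj a0 a1 a2 a3 a12 a13 a23 a123 b0 b1 b2 b3 b12 b13 b23 b123 :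
  mvec a0 a1 a2 a3 a12 a13 a23 a123 = mvec b0 b1 b2 b3 b12 b13 b23 b123 ->
  [/\ a0 = b0, a1 = b1, a2 = b2 & a3 = b3] /\
  [/\ a12 = b12, a13 = b13, a23 = b23 & a123 = b123].
Proof.
move=> E; have K a b c := congr1 (fun u => u (bset a b c)) E.
split; split; [move: (K false false false)|move: (K true false false)
  |move: (K false true false)|move: (K false false true)|move: (K true true false)
  |move: (K true false true)|move: (K false true true)|move: (K true true true)];
  by rewrite !mvec_bset.
Qed.

Lemma mvec_scale f a0 a1 a2 a3 a12 a13 a23 a123 :
  (fun S => f * mvec a0 a1 a2 a3 a12 a13 a23 a123 S) =
  mvec (f * a0) (f * a1) (f * a2) (f * a3) (f * a12) (f * a13) (f * a23) (f * a123).
Proof. by apply/funext; apply: bset_ind => [] [] [] []; rewrite !mvec_bset. Qed.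

Lemma homog_mvec0 a0 : homog 0 (mvec a0 0 0 0 0 0 0 0).
Proof. by apply: bset_ind => [] [] [] []; rewrite card_bset mvec_bset. Qed.

Lemma homog_mvec1 a1 a2 a3 : homog 1 (mvec 0 a1 a2 a3 0 0 0 0).
Proof. by apply: bset_ind => [] [] [] []; rewrite card_bset mvec_bset. Qed.

Lemma homog_mvec2 a12 a13 a23 : homog 2 (mvec 0 0 0 0 a12 a13 a23 0).
Proof. by apply: bset_ind => [] [] [] []; rewrite card_bset mvec_bset. Qed.

Lemma homog_mvec3 a123 : homog 3 (mvec 0 0 0 0 0 0 0 a123).
Proof. by apply: bset_ind => [] [] [] []; rewrite card_bset mvec_bset. Qed.

Lemma homog0E u : homog 0 u -> u = mvec (c0 u) 0 0 0 0 0 0 0.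
Proof.
move=> hu; rewrite {1}(mvecE u).
by rewrite (hu (bset true false false)) ?(hu (bset false true false))
  ?(hu (bset false false true)) ?(hu (bset true true false))
  ?(hu (bset true false true)) ?(hu (bset false true true))
  ?(hu (bset true true true)) ?card_bset.
Qed.

Lemma homog1E u : homog 1 u -> u = mvec 0 (c1 u) (c2 u) (c3 u) 0 0 0 0.
Proof.
move=> hu; rewrite {1}(mvecE u) (hu (bset false false false)) ?card_bset//.
by rewrite (hu (bset true true false)) ?(hu (bset true false true))
  ?(hu (bset false true true)) ?(hu (bset true true true)) ?card_bset.
Qed.

Lemma homog2E u : homog 2 u -> u = mvec 0 0 0 0 (c12 u) (c13 u) (c23 u) 0.
Proof.
move=> hu; rewrite {1}(mvecE u) (hu (bset false false false)) ?card_bset//.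
by rewrite (hu (bset true false false)) ?(hu (bset false true false))
  ?(hu (bset false false true)) ?(hu (bset true true true)) ?card_bset.
Qed.

Lemma homog3E u : homog 3 u -> u = mvec 0 0 0 0 0 0 0 (c123 u).
Proof.
move=> hu; rewrite {1}(mvecE u).
by rewrite (hu (bset false false false)) ?(hu (bset true false false))
  ?(hu (bset false true false)) ?(hu (bset false false true))
  ?(hu (bset true true false)) ?(hu (bset true false true))
  ?(hu (bset false true true)) ?card_bset.
Qed.

Lemma homog_gt3 p u : (3 < p)%N -> homog p u -> u = 0.
Proof.
move=> p3 hu; apply/funext => S; apply: hu; rewrite ltn_eqF//.
by apply: leq_ltn_trans p3; rewrite -[leqRHS]card_ord max_card.
Qed.

Lemma mul_mv_xy : mul_mv (mvec 0 1 0 0 0 0 0 0) (mvec 0 0 1 0 0 0 0 0) = mvec 0 0 0 0 1 0 0 0.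
Proof.
apply/funext; apply: bset_ind => [] [] [] []; rewrite mul_mv_bset /= !mvec_bset /sgn /=; ring.
Qed.

Lemma mul_mv_xyz : mul_mv (mvec 0 0 0 0 1 0 0 0) (mvec 0 0 0 1 0 0 0 0) = mvec 0 0 0 0 0 0 0 1.
Proof.
apply/funext; apply: bset_ind => [] [] [] []; rewrite mul_mv_bset /= !mvec_bset /sgn /=; ring.
Qed.

Variable D : 'I_3 -> A -> A.
Hypotheses (D0 : forall i, D i 0 = 0) (D1 : forall i, D i 1 = 0).

Lemma bracket_mvec0_xy h : bracket_mv D (mvec h 0 0 0 0 0 0 0) (mvec 0 0 0 0 1 0 0 0)
  = mvec 0 (D iy h) (- D ix h) 0 0 0 0 0.
Proof.
have [[b0 b1 b2 b3] [b12 b13 b23 b123]] :=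
  bracket_mvE D (mvec h 0 0 0 0 0 0 0) (mvec 0 0 0 0 1 0 0 0).
rewrite [LHS]mvecE b0 b1 b2 b3 b12 b13 b23 b123 !mvec_bset /= !D1 !D0.
by congr mvec; ring.
Qed.

Lemma bracket_mvec3_xy h : bracket_mv D (mvec 0 0 0 h 0 0 0 0) (mvec 0 0 0 0 1 0 0 0)
  = mvec 0 0 0 0 0 (- D iy h) (D ix h) 0.
Proof.
have [[b0 b1 b2 b3] [b12 b13 b23 b123]] :=
  bracket_mvE D (mvec 0 0 0 h 0 0 0 0) (mvec 0 0 0 0 1 0 0 0).
rewrite [LHS]mvecE b0 b1 b2 b3 b12 b13 b23 b123 !mvec_bset /= !D1 !D0.
by congr mvec; ring.
Qed.

End Components.

Section HeisenbergCohomology.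
Variable R : realType.
Notation A := (smf R 3).
Notation D := (@smf_der R 3).
Notation z := (zA R).
Notation d := (dheis D z).
Implicit Types (u v w : {set 'I_3} -> A) (P Q : mvf R 3).

Let DD := @smf_derD R 3.
Let DM := @smf_derM R 3.
Let DC := @smf_derC R 3.
Lemma der_z i : D i z = (i == iz)%:R. Proof. exact: smf_der_coord. Qed.
Lemma derN i (f : A) : D i (- f) = - D i f. Proof. exact: (derivationN DD). Qed.
Lemma derB i (f g : A) : D i (f - g) = D i f - D i g. Proof. by rewrite DD derN. Qed.
Lemma der0 i : D i 0 = 0 :> A. Proof. exact: (derivation0 DD). Qed.
Lemma der1 i : D i 1 = 0 :> A. Proof. exact: (derivation1 DM). Qed.

Lemma d_mvec a0 a1 a2 a3 a12 a13 a23 a123 :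
  d (mvec a0 a1 a2 a3 a12 a13 a23 a123) =
  mvec 0 (z * D iy a0) (- (z * D ix a0)) 0 (z * (D ix a1 + D iy a2) - a3)
    (z * D iy a3) (- (z * D ix a3)) (z * (D ix a13 + D iy a23)).
Proof.
have [[e0 e1 e2 e3] [e12 e13 e23 e123]] :=
  dheisE DD (der_z ix) (der_z iy) (der_z iz) (mvec a0 a1 a2 a3 a12 a13 a23 a123).
by rewrite [LHS]mvecE e0 e1 e2 e3 e12 e13 e23 e123 !mvec_bset.
Qed.

Lemma d_mul u v : d (mul_mv u v) = mul_mv (d u) v + mul_mv (parity_mv u) (d v).
Proof.
by apply/funext => S; rewrite (dheis_mul DD DM (der_z ix) (der_z iy) (der_z iz)).
Qed.

Lemma d_bracket u v : d (bracket_mv D u v)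
  = bracket_mv D (d u) v - bracket_mv D (parity_mv u) (d v).
Proof.
apply/funext => S.
by rewrite (dheis_bracket DD DM DC (der_z ix) (der_z iy) (der_z iz)).
Qed.

Lemma dB u v : d (u - v) = d u - d v.
Proof. by apply/funext => S; rewrite /dheis (bracket_mvBr derB). Qed.

Lemma d0 : d 0 = 0. Proof. by rewrite -{1}(subrr 0) dB subrr. Qed.
Lemma dN u : d (- u) = - d u. Proof. by rewrite -sub0r dB d0 sub0r. Qed.
Lemma dD u v : d (u + v) = d u + d v. Proof. by rewrite -{1}[v]opprK dB dN opprK. Qed.

Lemma homogD p u v : homog p u -> homog p v -> homog p (u + v).
Proof. by move=> hu hv S Sp; rewrite fctE hu ?hv ?addr0. Qed.

Lemma homogN p u : homog p u -> homog p (- u).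
Proof. by move=> hu S Sp; rewrite fctE hu ?oppr0. Qed.

Lemma homog_parity p u : homog p u -> homog p (parity_mv u).
Proof. by move=> hu S Sp; rewrite /parity_mv hu ?mulr0. Qed.

Lemma homog0 p : homog p (0 : {set 'I_3} -> A).
Proof. by []. Qed.

Lemma parity_mvK u : parity_mv (parity_mv u) = u.
Proof. by apply/funext => S; rewrite /parity_mv mulrA -expr2 sqrr_sign mul1r. Qed.

Lemma homog_parityE p u : homog p u -> parity_mv u = (fun S => (-1) ^+ p * u S).
Proof.
move=> hu; apply/funext => S; rewrite /parity_mv.
by have [->//|/hu->] := eqVneq #|S| p; rewrite !mulr0.
Qed.

Lemma d_parity p u : homog p u -> d u = 0 -> d (parity_mv u) = 0.
Proof.
move=> hu du; rewrite (homog_parityE hu) -signr_odd.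
case: (odd p); last by rewrite (_ : (fun S => _) = u)//; apply/funext => S; rewrite mul1r.
rewrite (_ : (fun S => _) = - u) ?dN ?du ?oppr0//.
by apply/funext => S; rewrite mulN1r.
Qed.

Definition exact_mv (p : nat) u : Prop :=
  match p with
  | 0%N => u = 0
  | q.+1 => exists2 w, homog q w & u = d w
  end.

Lemma exact0 p : exact_mv p 0.
Proof. by case: p => // p; exists 0; rewrite ?d0. Qed.

Lemma exactD p u v : exact_mv p u -> exact_mv p v -> exact_mv p (u + v).
Proof.
case: p => [->->|p [w hw ->] [w' hw' ->]]; first by rewrite addr0.
by exists (w + w'); [exact: homogD|rewrite dD].
Qed.

Lemma exactN p u : exact_mv p u -> exact_mv p (- u).
Proof.
case: p => [->|p [w hw ->]]; first by rewrite oppr0.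
by exists (- w); [exact: homogN|rewrite dN].
Qed.

Lemma mul_mv0l v : mul_mv 0 v = 0 :> ({set 'I_3} -> A).
Proof. by apply/funext => S; rewrite -{1}(subrr 0) mul_mvBl subrr. Qed.
Lemma mul_mv0r v : mul_mv v 0 = 0 :> ({set 'I_3} -> A).
Proof. by apply/funext => S; rewrite -{1}(subrr 0) mul_mvBr subrr. Qed.
Lemma bracket_mv0l v : bracket_mv D 0 v = 0.
Proof. by apply/funext => S; rewrite -{1}(subrr 0) (bracket_mvBl derB) subrr. Qed.
Lemma bracket_mv0r v : bracket_mv D v 0 = 0.
Proof. by apply/funext => S; rewrite -{1}(subrr 0) (bracket_mvBr derB) subrr. Qed.

Lemma exact_mul_l p q u v : exact_mv p u -> homog q v -> d v = 0 ->
  exact_mv (p + q) (mul_mv u v).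
Proof.
case: p => [->|p [w hw ->]] hv dv; first by rewrite mul_mv0l; exact: exact0.
exists (mul_mv w v); first exact: mul_mv_homog.
by rewrite d_mul dv mul_mv0r addr0.
Qed.

(** The primitive is built with [parity_mv u] in place of u: the involution cancels the sign that
    the Leibniz rule puts on the second term. [exact_bracket_r] uses the same device. *)
Lemma exact_mul_r p q u v : homog p u -> d u = 0 -> exact_mv q v ->
  exact_mv (p + q) (mul_mv u v).
Proof.
case: q => [|q] hu du; first by move=> ->; rewrite mul_mv0r; exact: exact0.
move=> [w hw ->]; rewrite addnS; exists (mul_mv (parity_mv u) w).
  by apply: mul_mv_homog => //; exact: homog_parity.
by rewrite d_mul parity_mvK (d_parity hu du) mul_mv0l add0r.
Qed.

(* In degrees (0, 0) the bracket vanishes, which is what bracket_deg 0 0 = 0 requires. *)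
Lemma exact_d_bracket p q u v : homog p u -> homog q v ->
  exact_mv (p + q) (d (bracket_mv D u v)).
Proof.
move=> hu hv; case E: (p + q)%N => [|r].
  rewrite (_ : bracket_mv D u v = 0) ?d0//; apply/funext => S.
  by apply: (bracket_mv_homogS derB hu hv); rewrite E.
by exists (bracket_mv D u v) => //; rewrite -[r]/(r.+1.-1) -E; exact: (bracket_mv_homog derB).
Qed.

Lemma exact_bracket_l p q u v : exact_mv p u -> homog q v -> d v = 0 ->
  exact_mv (bracket_deg p q) (bracket_mv D u v).
Proof.
case: p => [->|p [w hw ->]] hv dv; first by rewrite bracket_mv0l; exact: exact0.
have -> : bracket_mv D (d w) v = d (bracket_mv D w v).
  by rewrite d_bracket dv bracket_mv0r subr0.
exact: exact_d_bracket.
Qed.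

Lemma exact_bracket_r p q u v : homog p u -> d u = 0 -> exact_mv q v ->
  exact_mv (bracket_deg p q) (bracket_mv D u v).
Proof.
case: q => [|q] hu du; first by move=> ->; rewrite bracket_mv0r; exact: exact0.
move=> [w hw ->].
have -> : bracket_mv D u (d w) = - d (bracket_mv D (parity_mv u) w).
  by rewrite d_bracket parity_mvK (d_parity hu du) bracket_mv0l sub0r opprK.
rewrite /bracket_deg addnS /=; apply/exactN/exact_d_bracket => //.
exact: homog_parity.
Qed.

End HeisenbergCohomology.

(** * Representatives and the induced operations *)

Section Representatives.
Variable R : realType.
Notation A := (smf R 3).
Notation D := (@smf_der R 3).
Notation z := (zA R).
Notation d := (dheis D z).
Implicit Types (u v w : {set 'I_3} -> A) (P Q : mvf R 3) (h k : A).

Lemma emb_mvec0 h : fn (smf_fun h) = emb (mvec h 0 0 0 0 0 0 0).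
Proof.
apply/funext; apply: bset_ind => [] [] [] []; apply/funext => p;
  by rewrite /fn /emb mvec_bset bset0 bset_inj.
Qed.

Lemma dxE : dx = emb (mvec 0 1 0 0 0 0 0 0) :> mvf R 3.
Proof.
apply/funext; apply: bset_ind => [] [] [] []; apply/funext => p;
  by rewrite /dx /vf /emb mvec_bset bset1x bset_inj.
Qed.

Lemma dyE : dy = emb (mvec 0 0 1 0 0 0 0 0) :> mvf R 3.
Proof.
apply/funext; apply: bset_ind => [] [] [] []; apply/funext => p;
  by rewrite /dy /vf /emb mvec_bset bset1y bset_inj.
Qed.

Lemma dzE : dz = emb (mvec 0 0 0 1 0 0 0 0) :> mvf R 3.
Proof.
apply/funext; apply: bset_ind => [] [] [] []; apply/funext => p;
  by rewrite /dz /vf /emb mvec_bset bset1z bset_inj.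
Qed.

Lemma scaleE h u : scale (smf_fun h) (emb u) = emb (fun S => h * u S).
Proof. by []. Qed.

Lemma dxyE : dxy = emb (mvec 0 0 0 0 1 0 0 0) :> mvf R 3.
Proof.
rewrite /dxy dxE dyE -emb_mul; congr emb; exact: mul_mv_xy.
Qed.

Lemma dxyzE : dxyz = emb (mvec 0 0 0 0 0 0 0 1) :> mvf R 3.
Proof.
rewrite /dxyz -/dxy dxyE dzE -emb_mul; congr emb; exact: mul_mv_xyz.
Qed.

Lemma heisE : heis = emb (heis_mv z).
Proof.
rewrite /heis dxyE (scaleE z) mvec_scale !mulr0 mulr1; congr emb.
by apply/funext; apply: bset_ind => [] [] [] []; rewrite mvec_bset heis_bset.
Qed.

Lemma schouten_heis u : schouten heis (emb u) = emb (d u).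
Proof. by rewrite heisE -emb_bracket. Qed.

Lemma fn_dxyE h : schouten (fn (smf_fun h)) dxy = emb (mvec 0 (D iy h) (- D ix h) 0 0 0 0 0).
Proof.
rewrite emb_mvec0 dxyE -emb_bracket.
by rewrite (bracket_mvec0_xy (@der0 R) (@der1 R)).
Qed.

Lemma dz_dxyE h : schouten (scale (smf_fun h) dz) dxy
  = emb (mvec 0 0 0 0 0 (- D iy h) (D ix h) 0).
Proof.
rewrite dzE (scaleE h) mvec_scale !mulr0 mulr1 dxyE -emb_bracket.
by rewrite (bracket_mvec3_xy (@der0 R) (@der1 R)).
Qed.

Definition half : A :=
  to_smf ((fun m : nat => Ck_cst _ m 2^-1) : smooth ((fun=> 2^-1) : 'rV[R]_3 -> R)).

Lemma half2 : half + half = 1.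
Proof. by apply: smfP => p; rewrite smfD /= [RHS]splitr mul1r. Qed.

Lemma der_half i : D i half = 0.
Proof. by apply: smfP => p; rewrite smf_derE /pder /= derive_cst. Qed.

Lemma eulerE : eulerR = emb (mvec 0 (xA R * half) (yA R * half) z 0 0 0 0).
Proof.
rewrite /eulerR dxE dyE dzE (scaleE (xA R * half)) (scaleE (yA R * half)) (scaleE z).
by rewrite -!embD !mvec_scale !mulr0 !mulr1 !mvecD !addr0 !add0r.
Qed.

Lemma rep1E (f : R -> R) (g : R * R -> R) (sf : smooth f) (sg : smooth g) :
  scale (of_z f) eulerR + schouten (fn (of_xy g)) dxy
  = emb (mvec 0 (smf_of_z sf * (xA R * half) + D iy (smf_of_xy sg))
         (smf_of_z sf * (yA R * half) - D ix (smf_of_xy sg)) (smf_of_z sf * z) 0 0 0 0).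
Proof.
rewrite (fn_dxyE (smf_of_xy sg)) eulerE (scaleE (smf_of_z sf)) mvec_scale -embD mvecD.
by rewrite !mulr0 !addr0.
Qed.

Lemma rep2E (g1 g2 : R * R -> R) (sg1 : smooth g1) (sg2 : smooth g2) :
  let m := smf_of_xy sg1 + z * smf_of_xy sg2 in
  schouten (scale (fun q => of_xy g1 q + zc q * of_xy g2 q) dz) dxy
  = emb (mvec 0 0 0 0 0 (- D iy m) (D ix m) 0).
Proof. by move=> m; rewrite -dz_dxyE. Qed.

Lemma rep3E (h : A) : scale (smf_fun h) dxyz = emb (mvec 0 0 0 0 0 0 0 h).
Proof. by rewrite dxyzE (scaleE h) mvec_scale !mulr0 mulr1. Qed.

Lemma mvfieldE p u : mvfield p (emb u) <-> homog p u.
Proof.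
split=> [[_ H] S /H E|H]; first by apply: smfP => q; rewrite -[LHS]/(emb u S q) E.
by split=> [S|S /H E]; [exact: smf_smooth|rewrite /emb E].
Qed.

Lemma mvfield_emb p P : mvfield p P -> exists2 u, P = emb u & homog p u.
Proof. by move=> hP; have [u E] := embP hP.1; exists u => //; apply/mvfieldE; rewrite -E. Qed.

Lemma cocycleE p u : cocycle heis p (emb u) <-> homog p u /\ d u = 0.
Proof.
rewrite /cocycle mvfieldE schouten_heis -emb0.
by split=> -[hu E]; split=> //; [exact: emb_inj|rewrite E].
Qed.

Lemma cocycle_emb p P : cocycle heis p P -> exists u, [/\ P = emb u, homog p u & d u = 0].
Proof.
move=> cP; have [u E _] := mvfield_emb cP.1; move: cP; rewrite E => /cocycleE[hu du].
by exists u.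
Qed.

Lemma coboundaryE p u : coboundary heis p (emb u) <-> exact_mv p u.
Proof.
case: p => [|p] /=; first by rewrite -emb0; split=> [/emb_inj|->].
split=> [[Q /mvfield_emb[w -> hw]]|[w hw ->]].
  by rewrite schouten_heis => /emb_inj E; exists w.
by exists (emb w); [exact/mvfieldE|rewrite schouten_heis].
Qed.

Lemma pclass_emb p u Q : homog p u -> d u = 0 -> pclass heis p (emb u) Q <->
  exists v, [/\ Q = emb v, homog p v, d v = 0 & exact_mv p (v - u)].
Proof.
move=> hu du; split=> [[/cocycle_emb[v [-> hv dv]] cob]|[v [-> hv dv ex]]].
  by exists v; split=> //; apply/coboundaryE; rewrite embB.
by split; [apply/cocycleE|rewrite -embB; apply/coboundaryE].
Qed.

Lemma pclass_eq p u v : homog p u -> d u = 0 -> homog p v -> d v = 0 ->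
  exact_mv p (u - v) -> pclass heis p (emb u) = pclass heis p (emb v).
Proof.
have half_incl u' v' : homog p u' -> d u' = 0 -> homog p v' -> d v' = 0 ->
    exact_mv p (u' - v') -> pclass heis p (emb u') `<=` pclass heis p (emb v').
  move=> hu du hv dv ex T /(pclass_emb _ hu du)[t [-> ht dt ext]].
  apply/(pclass_emb _ hv dv); exists t; split=> //.
  by rewrite -[t](subrK u') -addrA; exact: exactD.
move=> hu du hv dv ex; apply/seteqP; split; apply: half_incl => //.
by rewrite -opprB; exact: exactN.
Qed.

(** The argument common to both operations: a biadditive operation that preserves cocycles, and is
    exact as soon as one argument is exact and the other closed, passes to classes. *)
Lemma descends_op (op : mvf R 3 -> mvf R 3 -> mvf R 3)
    (opA : ({set 'I_3} -> A) -> ({set 'I_3} -> A) -> {set 'I_3} -> A)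
    (deg : nat -> nat -> nat) :
  (forall u v, op (emb u) (emb v) = emb (opA u v)) ->
  (forall p q u v, homog p u -> homog q v -> homog (deg p q) (opA u v)) ->
  (forall p u v, homog p u -> d u = 0 -> d v = 0 -> d (opA u v) = 0) ->
  (forall u u' v, opA (u - u') v = opA u v - opA u' v) ->
  (forall u v v', opA u (v - v') = opA u v - opA u v') ->
  (forall p q u v, exact_mv p u -> homog q v -> d v = 0 -> exact_mv (deg p q) (opA u v)) ->
  (forall p q u v, homog p u -> d u = 0 -> exact_mv q v -> exact_mv (deg p q) (opA u v)) ->
  descends heis op deg.
Proof.
move=> opE hop dop opBl opBr exl exr p q P Q.
move=> /cocycle_emb[u [-> hu du]] /cocycle_emb[v [-> hv dv]].
have huv := hop _ _ _ _ hu hv; have duv := dop _ _ _ hu du dv.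
rewrite opE; split; first exact/cocycleE.
apply/seteqP; split=> T.
  move=> [P' [Q' []]] /(pclass_emb _ hu du)[u' [-> hu' du' eu]].
  move=> /(pclass_emb _ hv dv)[v' [-> hv' dv' ev]].
  rewrite opE => /(pclass_emb _ (hop _ _ _ _ hu' hv') (dop _ _ _ hu' du' dv')).
  move=> [t [-> ht dt et]]; apply/(pclass_emb _ huv duv); exists t; split=> //.
  (* A change of both arguments is split into a change of the first, against the closed v', and a
     change of the second, against the closed u. *)
  have -> : t - opA u v = (t - opA u' v') + (opA (u' - u) v' + opA u (v' - v)).
    by rewrite opBl opBr subrKA subrKA.
  by apply: exactD => //; apply: exactD; [exact: exl|exact: exr].
move=> hT; exists (emb u), (emb v); rewrite opE.
split=> //; apply/pclass_emb => //.
  by exists u; split=> //; rewrite subrr; exact: exact0.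
by exists v; split=> //; rewrite subrr; exact: exact0.
Qed.

Lemma descends_wedge : descends heis (@wedge R 3) addn.
Proof.
apply: (descends_op (opA := @mul_mv _ _)).
- by move=> u v; rewrite emb_mul.
- by move=> p q u v; exact: mul_mv_homog.
- by move=> p u v hu du dv; rewrite d_mul du dv mul_mv0l mul_mv0r addr0.
- by move=> u u' v; apply/funext => S; rewrite mul_mvBl.
- by move=> u v v'; apply/funext => S; rewrite mul_mvBr.
- exact: exact_mul_l.
- exact: exact_mul_r.
Qed.

Lemma descends_schouten : descends heis (@schouten R 3) bracket_deg.
Proof.
apply: (descends_op (opA := bracket_mv D)).
- by move=> u v; rewrite emb_bracket.
- by move=> p q u v; exact: (bracket_mv_homog (@derB R)).
- by move=> p u v hu du dv; rewrite d_bracket du dv bracket_mv0l bracket_mv0r subr0.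
- by move=> u u' v; apply/funext => S; rewrite (bracket_mvBl (@derB R)).
- by move=> u v v'; apply/funext => S; rewrite (bracket_mvBr (@derB R)).
- exact: exact_bracket_l.
- exact: exact_bracket_r.
Qed.

End Representatives.

(** * Relations and normal forms *)

Section NormalForm.
Variable R : realType.
Notation A := (smf R 3).
Notation D := (@smf_der R 3).
Notation z := (zA R).
Notation d := (dheis D z).
Notation hf := (half R).
Implicit Types (u v w : {set 'I_3} -> A) (P Q : mvf R 3) (h k : A).

Lemma der_zM i h : i != iz -> D i (z * h) = z * D i h.
Proof. by move=> /negPf iz0; rewrite smf_derM der_z iz0 mul0r add0r. Qed.

Lemma zA_regB h k : z * h = z * k -> h = k.
Proof. by move=> E; apply/eqP; rewrite -subr_eq0; apply/eqP/zA_reg; rewrite mulrBr E subrr. Qed.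

Lemma d_mvec1_hamiltonian k : d (mvec 0 (D iy k) (- D ix k) 0 0 0 0 0) = 0.
Proof.
by rewrite d_mvec !der0 derN (smf_derC iy ix) !subrr !mulr0 !oppr0 addr0 mulr0 mvec0.
Qed.

Lemma d_mvec2_hamiltonian a k : d (mvec 0 0 0 0 a (- D iy k) (D ix k) 0) = 0.
Proof.
by rewrite d_mvec !der0 derN (smf_derC iy ix) addNr addr0 !mulr0 !oppr0 addr0 mvec0.
Qed.

Lemma d_mvec3 k : d (mvec 0 0 0 0 0 0 0 k) = 0.
Proof. by rewrite d_mvec !der0 addr0 !mulr0 !oppr0 addr0 mvec0. Qed.

(** The coefficients x/2 and y/2 of R have divergence 1 in (x, y). This makes z times the divergence
    of F R equal to its z-coefficient, so that F R is closed. *)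
Lemma der_euler (F : A) : D ix F = 0 -> D iy F = 0 ->
  D ix (F * (xA R * hf)) + D iy (F * (yA R * hf)) = F.
Proof.
move=> Fx Fy; rewrite !smf_derM Fx Fy !der_half !smf_der_coord /=.
by rewrite !mul0r !add0r !mul1r !mulr0 !addr0 -mulrDr half2 mulr1.
Qed.

Lemma d_euler (F : A) : D ix F = 0 -> D iy F = 0 ->
  d (mvec 0 (F * (xA R * hf)) (F * (yA R * hf)) (F * z) 0 0 0 0) = 0.
Proof.
move=> Fx Fy; rewrite d_mvec !der0 der_euler// [F * z]mulrC !der_zM// Fx Fy.
by rewrite subrr addr0 !mulr0 !oppr0 mvec0.
Qed.

(** Since z is constant for D_x and D_y, the differential of the function k is the Hamiltonian field
    of zk for the constant bivector. *)
Lemma exact_hamiltonian_z k :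
  exact_mv 1 (mvec 0 (D iy (z * k)) (- D ix (z * k)) 0 0 0 0 0).
Proof.
exists (mvec k 0 0 0 0 0 0 0); first exact: homog_mvec0.
by rewrite d_mvec !der0 !der_zM// addr0 !mulr0 !oppr0 addr0.
Qed.

Lemma relation1 h : exact_mv 1 (mvec 0 (D iy h) (- D ix h) 0 0 0 0 0
  - mvec 0 (D iy (smf_at_z0 h)) (- D ix (smf_at_z0 h)) 0 0 0 0 0).
Proof.
have [k E] := hadamard_z h.
have {}E : h - smf_at_z0 h = z * k by rewrite {1}E addrC addKr.
by rewrite mvecB -opprD -!derB E !subrr; exact: exact_hamiltonian_z.
Qed.

(** The coefficient on the right of the second relation: the Taylor polynomial of h1 of order one in
    z, with its linear term corrected by h2. *)
Definition rel2_fun h1 h2 : A := smf_at_z0 h1 + z * (smf_at_z0 (D iz h1) - smf_at_z0 h2).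

(** Expanding h1 to second order in z (quotients H, H') and h2 to first order (quotient K) gives h1
    - [rel2_fun h1 h2] = -zc. Taking c as z-coefficient of the primitive settles the components 13
    and 23; the component 12 then asks for z times the (x, y)-divergence to be z(K - H'), which an
    x-primitive provides. *)
Lemma relation2 h1 h2 : exact_mv 2 (mvec 0 0 0 0 h2 (- D iy h1) (D ix h1) 0
  - mvec 0 0 0 0 0 (- D iy (rel2_fun h1 h2)) (D ix (rel2_fun h1 h2)) 0).
Proof.
have [H E1] := hadamard_z h1; have [H' E2] := hadamard_z H.
have [K E3] := hadamard_z h2.
have E4 : smf_at_z0 (D iz h1) = smf_at_z0 H.
  rewrite [in LHS]E1 smf_derD der_at0 add0r smf_derM der_z mul1r.
  by rewrite at0D at0M at0_z mul0r addr0.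
pose c := - (z * H' + smf_at_z0 h2).
have E5 : h1 - rel2_fun h1 h2 = - (z * c).
  rewrite /rel2_fun E4 {1}E1 {1}E2 /c; ring.
have E6 i : i != iz -> D i h1 - D i (rel2_fun h1 h2) = - (z * D i c).
  by move=> iz0; rewrite -derB E5 derN der_zM.
exists (mvec 0 (smf_primitive ix (K - H')) 0 c 0 0 0 0); first exact: homog_mvec1.
rewrite mvecB d_mvec !der0 der_prim !subrr addr0 !mulr0 oppr0 !addr0; congr mvec.
- rewrite /c {1}E3; ring.
- by rewrite -opprD E6// opprK.
- exact: E6.
- by rewrite mulr0.
Qed.

Lemma relation3 h : exact_mv 3 (mvec 0 0 0 0 0 0 0 h - mvec 0 0 0 0 0 0 0 (smf_at_z0 h)).
Proof.
have [k E] := hadamard_z h.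
have {}E : h - smf_at_z0 h = z * k by rewrite {1}E addrC addKr.
(* Every multiple of z in top degree is exact: zk is z times the x-derivative of an x-primitive of
   k. *)
exists (mvec 0 0 0 0 0 (smf_primitive ix k) 0 0); first exact: homog_mvec2.
by rewrite mvecB d_mvec !der0 der_prim E !addr0 !mulr0 !subrr oppr0.
Qed.

Lemma heis_relation_sound p P Q : heis_relation p P Q ->
  exists u v, [/\ P = emb u, Q = emb v, homog p u /\ d u = 0,
    homog p v /\ d v = 0 & exact_mv p (u - v)].
Proof.
case=> [h sh|h1 h2 sh1 sh2|h sh].
- pose k : A := to_smf sh; exists (mvec 0 (D iy k) (- D ix k) 0 0 0 0 0).
  exists (mvec 0 (D iy (smf_at_z0 k)) (- D ix (smf_at_z0 k)) 0 0 0 0 0).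
  rewrite (fn_dxyE k) (fn_dxyE (smf_at_z0 k)); split=> //.
  + by split; [exact: homog_mvec1|exact: d_mvec1_hamiltonian].
  + by split; [exact: homog_mvec1|exact: d_mvec1_hamiltonian].
  + exact: relation1.
- pose k1 : A := to_smf sh1; pose k2 : A := to_smf sh2.
  pose m := rel2_fun k1 k2.
  exists (mvec 0 0 0 0 k2 (- D iy k1) (D ix k1) 0).
  exists (mvec 0 0 0 0 0 (- D iy m) (D ix m) 0).
  rewrite (dz_dxyE k1) (dz_dxyE m) dxyE (scaleE k2) mvec_scale -embD mvecD !mulr0 mulr1 !addr0 add0r.
  split=> //.
  + by split; [exact: homog_mvec2|exact: d_mvec2_hamiltonian].
  + by split; [exact: homog_mvec2|exact: d_mvec2_hamiltonian].
  + exact: relation2.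
- pose k : A := to_smf sh; exists (mvec 0 0 0 0 0 0 0 k), (mvec 0 0 0 0 0 0 0 (smf_at_z0 k)).
  rewrite (rep3E k) (rep3E (smf_at_z0 k)); split=> //.
  + by split; [exact: homog_mvec3|exact: d_mvec3].
  + by split; [exact: homog_mvec3|exact: d_mvec3].
  + exact: relation3.
Qed.

(** Every rule preserves closedness and the cohomology class; for transitivity, injectivity of [emb]
    identifies the two descriptions of the middle field. *)
Lemma derivable_sound p P Q : derivable_from heis (@heis_relation R) p P Q ->
  exists u v, [/\ P = emb u, Q = emb v, homog p u /\ d u = 0,
    homog p v /\ d v = 0 & exact_mv p (u - v)].
Proof.
elim=> {p P Q} [p P Q _ /heis_relation_sound//|p P /cocycle_emb[u [-> hu du]]
  |p P Q _ [u [v [-> -> hu hv ex]]]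
  |p P Q T _ [u [v [-> -> hu hv ex]]] _ [u' [v' [/emb_inj<- -> _ hv' ex']]]
  |p P Q P' Q' _ [u [v [-> -> [hu du] [hv dv] ex]]] _ [u' [v' [-> -> [hu' du'] [hv' dv'] ex']]]].
- by exists u, u; split=> //; rewrite subrr; exact: exact0.
- by exists v, u; split=> //; rewrite -opprB; exact: exactN.
- by exists u, v'; split=> //; rewrite -(subrKA v); exact: exactD.
- exists (u + u'), (v + v'); rewrite !embD !dD du du' dv dv' addr0.
  by split=> //; [split=> //; exact: homogD|split=> //; exact: homogD
    |rewrite opprD addrACA; exact: exactD].
Qed.

Lemma derivable_pclass p P Q : derivable_from heis (@heis_relation R) p P Q ->
  pclass heis p P = pclass heis p Q.
Proof. by move=> /derivable_sound[u [v [-> -> [hu du] [hv dv] ex]]]; exact: pclass_eq. Qed.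

Lemma representative_cocycle p P : representative p P -> cocycle heis p P.
Proof.
case: p => [|[|[|[|p]]]] /=.
- move=> [f sf ->]; rewrite (emb_mvec0 (smf_of_z sf)); apply/cocycleE; split; first exact: homog_mvec0.
  by rewrite d_mvec !der0 !der_fz// addr0 !mulr0 !oppr0 addr0 mvec0.
- move=> [f [g [sf [sg _] ->]]]; rewrite (fn_dxyE (smf_of_xy sg)) eulerE (scaleE (smf_of_z sf)) mvec_scale !mulr0.
  rewrite -embD; apply/cocycleE; split; first by apply: homogD; exact: homog_mvec1.
  by rewrite dD d_mvec1_hamiltonian d_euler ?addr0//; exact: der_fz.
- move=> [g1 [g2 [[sg1 _] [sg2 _] ->]]]; rewrite (rep2E sg1 sg2); apply/cocycleE.
  by split; [exact: homog_mvec2|exact: d_mvec2_hamiltonian].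
- move=> [g sg ->]; rewrite (rep3E (smf_of_xy sg)); apply/cocycleE.
  by split; [exact: homog_mvec3|exact: d_mvec3].
- by move=> ->; rewrite -emb0; apply/cocycleE; split; [exact: homog0|exact: d0].
Qed.

(** Representatives contain only derivatives of g, so the normalisation at the origin costs nothing:
    the constant g(0, 0) is subtracted. *)
Lemma normalize_smooth0 (g : R * R -> R) (sg : smooth g) :
  exists (g' : R * R -> R) (sg' : smooth g'), g' (0, 0) = 0 /\
    forall i, D i (smf_of_xy sg') = D i (smf_of_xy sg).
Proof.
have sg' : smooth (g + (fun=> - g (0, 0))) by move=> m; apply: CkD; [exact: sg|exact: Ck_cst].
exists _, sg'; split=> [|i]; first exact: subrr.
pose c : A :=
  to_smf ((fun m : nat => Ck_cst _ m (- g (0, 0))) : smooth ((fun=> - g (0, 0)) : 'rV[R]_3 -> R)).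
have -> : smf_of_xy sg' = smf_of_xy sg + c by exact: smfP.
rewrite smf_derD (_ : D i c = 0) ?addr0//.
by apply: smfP => p; rewrite smf_derE /pder /= derive_cst.
Qed.

Lemma normal_form p P : cocycle heis p P -> exists W,
  representative p W /\ derivable_from heis (@heis_relation R) p P W.
Proof.
case: p => [|[|[|[|p]]]] cP; have [u [PE hu du]] := cocycle_emb cP.
- exists P; split; last exact: Der_refl.
  move: du; rewrite (homog0E hu) d_mvec -mvec0 => /mvec_inj[[_ Dy Dx _] _].
  have {}Dy := zA_reg Dy; move/eqP: Dx; rewrite oppr_eq0 => /eqP/zA_reg Dx.
  have [f [sf E]] := der_eq0_fz Dx Dy.
  by exists f => //; rewrite PE (homog0E hu) E -emb_mvec0.
- move: du; rewrite (homog1E hu) d_mvec -mvec0 => /mvec_inj[_ [E1 Dy Dx _]].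
  have {}Dy := zA_reg Dy; move/eqP: Dx; rewrite oppr_eq0 => /eqP/zA_reg Dx.
  (* The component 12 of the cocycle equation says that the z-coefficient is zF. The components 13
     and 23, after cancelling z twice, say that F depends on z alone. *)
  pose F : A := D ix (u (bset true false false)) + D iy (u (bset false true false)).
  have c3E : u (bset false false true) = z * F by apply/esym/eqP; rewrite -subr_eq0; apply/eqP.
  rewrite c3E !der_zM// in Dx Dy.
  have Fx := zA_reg Dx; have Fy := zA_reg Dy.
  have [f [sf FE]] := der_eq0_fz Fx Fy.
  (* Subtracting F R leaves a horizontal field without divergence, to which the Poincare lemma
     applies. *)
  have div0 : D ix (u (bset true false false) - F * (xA R * hf))
            + D iy (u (bset false true false) - F * (yA R * hf)) = 0.
    by rewrite !derB addrACA -opprD (der_euler Fx Fy) -/F subrr.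
  have [k [Ek1 Ek2]] := divergence_free_xy div0.
  have [g [sg gE]] := at0_fxyE k.
  have [g' [sg' [g'0 g'E]]] := normalize_smooth0 sg.
  have Pdec : P = scale (of_z f) eulerR + schouten (fn (smf_fun k)) dxy.
    rewrite PE (homog1E hu) fn_dxyE eulerE (scaleE (smf_of_z sf)) mvec_scale -embD mvecD -FE.
    rewrite Ek1 Ek2 opprK !mulr0 !addr0 c3E [z * F]mulrC.
    by rewrite ![F * _ + _]addrC !subrK.
  have c1P : cocycle heis 1 (scale (of_z f) eulerR).
    rewrite eulerE (scaleE (smf_of_z sf)) mvec_scale !mulr0; apply/cocycleE.
    by split; [exact: homog_mvec1|apply: d_euler; exact: der_fz].
  have c2P : cocycle heis 1 (schouten (fn (smf_fun k)) dxy).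
    by rewrite fn_dxyE; apply/cocycleE; split; [exact: homog_mvec1|exact: d_mvec1_hamiltonian].
  exists (scale (of_z f) eulerR + schouten (fn (of_xy g')) dxy).
  split; first by exists f, g'.
  (* The relation acts on the Hamiltonian summand and reflexivity on f(z) R; both rules ask for
     cocycles, so each summand was shown closed separately. *)
  rewrite Pdec; apply: Der_add; first exact: Der_refl.
  apply: Der_rel => //; rewrite (fn_dxyE (smf_of_xy sg')) !g'E -gE -fn_dxyE.
  exact/Rel1/smf_smooth.
- move: du; rewrite (homog2E hu) d_mvec -mvec0 => /mvec_inj[_ [_ _ _ /zA_reg E1]].
  (* The signs follow [dz_dxyE], whose coefficients are - D_y k and D_x k. *)
  have div0 : D ix (- u (bset true false true)) + D iy (- u (bset false true true)) = 0.
    by rewrite !derN -opprD E1 oppr0.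
  have [k [Ek1 Ek2]] := divergence_free_xy div0.
  pose h2 := u (bset true true false).
  have [g1 [sg1 g1E]] := at0_fxyE k.
  (* This restriction to z = 0 is the coefficient of z in [rel2_fun k h2]. *)
  have [g2 [sg2 g2E]] := at0_fxyE (D iz k - h2).
  have [g1' [sg1' [g1'0 g1'E]]] := normalize_smooth0 sg1.
  have [g2' [sg2' [g2'0 g2'E]]] := normalize_smooth0 sg2.
  have Pdec : P = schouten (scale (smf_fun k) dz) dxy + scale (smf_fun h2) dxy.
    rewrite PE (homog2E hu) dz_dxyE dxyE scaleE mvec_scale -embD mvecD.
    by rewrite Ek1 Ek2 !opprK !mulr0 mulr1 !addr0 add0r.
  exists (schouten (scale (fun q => of_xy g1' q + zc q * of_xy g2' q) dz) dxy).
  split; first by exists g1', g2'.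
  apply: Der_rel => //; rewrite Pdec (rep2E sg1' sg2').
  have <- : schouten (scale (smf_fun (rel2_fun k h2)) dz) dxy
     = emb (mvec 0 0 0 0 0 (- D iy (smf_of_xy sg1' + z * smf_of_xy sg2'))
         (D ix (smf_of_xy sg1' + z * smf_of_xy sg2')) 0).
    rewrite dz_dxyE /rel2_fun -at0N -at0D g1E g2E.
    by rewrite !smf_derD !der_zM// !g1'E !g2'E.
  by apply: Rel2; exact: smf_smooth.
- have [g [sg gE]] := at0_fxyE (u (bset true true true)).
  exists (scale (of_xy g) dxyz); split; first by exists g.
  apply: Der_rel => //; rewrite PE (homog3E hu) -rep3E.
  rewrite (_ : of_xy g = at_z0 (smf_fun (u (bset true true true)))).
    exact/Rel3/smf_smooth.
  exact: (congr1 (@smf_fun R 3) (esym gE)).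
- by exists P; split; [rewrite /= PE (homog_gt3 _ hu)|exact: Der_refl].
Qed.

Lemma der_fxy_at0 g (sg : smooth g) i : i != iz -> smf_at_z0 (D i (smf_of_xy sg)) = D i (smf_of_xy sg).
Proof. by move=> /negPf iz0; rewrite -[in RHS](at0_fxy sg) der_at0 iz0. Qed.

Lemma at0_zM h : smf_at_z0 (z * h) = 0.
Proof. by rewrite at0M at0_z mul0r. Qed.

(** Restriction to z = 0 compares the parts free of z; once these agree, one factor z cancels and a
    second restriction compares the coefficients of z. *)
Lemma der_eq_mod_z2 g1 g2 g1' g2' (sg1 : smooth g1) (sg2 : smooth g2)
    (sg1' : smooth g1') (sg2' : smooth g2') i k : i != iz ->
  D i (smf_of_xy sg1 + z * smf_of_xy sg2) - D i (smf_of_xy sg1' + z * smf_of_xy sg2') = - (z * (z * k)) ->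
  D i (smf_of_xy sg1 + z * smf_of_xy sg2) = D i (smf_of_xy sg1' + z * smf_of_xy sg2').
Proof.
move=> iz0; rewrite !smf_derD !der_zM// opprD addrACA -mulrBr => E.
have E1 : D i (smf_of_xy sg1) = D i (smf_of_xy sg1').
  have := congr1 (@smf_at_z0 R) E; rewrite at0D at0D !at0N !der_fxy_at0// !at0_zM addr0 oppr0.
  by move/eqP; rewrite subr_eq0 => /eqP.
move: E; rewrite E1 subrr add0r -mulrN => /zA_regB/(congr1 (@smf_at_z0 R)).
rewrite at0D !at0N !der_fxy_at0// at0_zM oppr0 => /eqP.
by rewrite subr_eq0 => /eqP ->.
Qed.

Lemma representative_unique p P Q : representative p P -> representative p Q ->
  coboundary heis p (P - Q) -> P = Q.
Proof.
case: p => [|[|[|[|p]]]] /=.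
- by move=> _ _ /eqP; rewrite subr_eq0 => /eqP.
- move=> [f [g [sf [sg _] ->]]] [f' [g' [sf' [sg' _] ->]]].
  rewrite (rep1E sf sg) (rep1E sf' sg') -embB => /(iffLR (@coboundaryE R 1 _))[w /homog0E ->].
  rewrite mvecB d_mvec !der0 => /mvec_inj[[_ E1 E2 E3] _].
  (* A coboundary in degree 1 has no z-component, which determines f; its other components are
     multiples of z and disappear on restriction to z = 0. *)
  have Ef : smf_of_z sf = smf_of_z sf'.
    apply: zA_regB; apply/eqP; rewrite -subr_eq0 [z * _]mulrC [z * smf_of_z sf']mulrC.
    by rewrite E3.
  move: E1 E2; rewrite Ef.
  have cancel (a b c e : A) : (a + b) - (a + c) = e -> b - c = e.
    by rewrite opprD addrACA subrr add0r.
  move=> /cancel/(congr1 (@smf_at_z0 R)) + /cancel/(congr1 (@smf_at_z0 R)).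
  rewrite !at0D !at0N !der_fxy_at0// !at0_zM oppr0 => /eqP + /eqP.
  by rewrite !subr_eq0 => /eqP ->; rewrite eqr_opp => /eqP ->.
- move=> [g1 [g2 [[sg1 _] [sg2 _] ->]]] [g1' [g2' [[sg1' _] [sg2' _] ->]]].
  rewrite (rep2E sg1 sg2) (rep2E sg1' sg2') -embB => /(iffLR (@coboundaryE R 2 _))[w /homog1E ->].
  (* Neither representative has a component 12, so the z-coefficient of the primitive w is z times
     the divergence of its horizontal part. The remaining components of the coboundary are then
     divisible by z^2. *)
  rewrite mvecB d_mvec subrr => /mvec_inj[_ [/esym/eqP]].
  rewrite subr_eq0 => /eqP <-; rewrite !der_zM// => E2 E3 _.
  have E2' : D iy (smf_of_xy sg1 + z * smf_of_xy sg2) - D iy (smf_of_xy sg1' + z * smf_of_xy sg2')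
      = - (z * (z * D iy (D ix (w (bset true false false)) + D iy (w (bset false true false))))).
    by rewrite -E2 opprD !opprK addrC.
  by rewrite (der_eq_mod_z2 _ E3)// (der_eq_mod_z2 _ E2').
- move=> [g sg ->] [g' sg' ->]; rewrite (rep3E (smf_of_xy sg)) (rep3E (smf_of_xy sg')) -embB.
  move=> /(iffLR (@coboundaryE R 3 _))[w /homog2E ->]; rewrite mvecB d_mvec => /mvec_inj[_ [_ _ _]].
  move=> /(congr1 (@smf_at_z0 R)); rewrite at0D at0N !at0_fxy at0_zM => /eqP.
  by rewrite subr_eq0 => /eqP ->.
- by move=> -> ->.
Qed.

End NormalForm.

(** * Casimir functions, unique representatives and induced operations *)

Section Conclusions.
Variable R : realType.
Notation A := (smf R 3).

Lemma casimirP (h : 'rV[R]_3 -> R) : smooth h ->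
  schouten heis (fn h) = 0 <-> exists2 f : R -> R, smooth f & h = of_z f.
Proof.
move=> sh; pose k : A := to_smf sh; split.
  rewrite (emb_mvec0 k) schouten_heis -emb0 => /emb_inj.
  rewrite d_mvec -mvec0 => /mvec_inj[[_ /zA_reg Dy /eqP + _] _].
  rewrite oppr_eq0 => /eqP/zA_reg Dx; have [f [sf E]] := der_eq0_fz Dx Dy.
  by exists f => //; exact: (congr1 (@smf_fun R 3) E).
move=> [f sf ->].
have [_] : cocycle heis 0 (fn (of_z f)) by apply: representative_cocycle; exists f.
by [].
Qed.

Lemma cohomology_representative p (c : set (mvf R 3)) : cohomology heis p c ->
  exists! P, representative p P /\ c P.
Proof.
move=> [P cP ->]; have [W [rW /derivable_sound]] := normal_form cP.
move=> [u [v [PE WE [hu du] [hv dv] ex]]]; subst P W.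
exists (emb v); split.
  split=> //; apply/pclass_emb => //; exists v; split=> //.
  by rewrite -opprB; exact: exactN.
move=> Q [rQ /(pclass_emb _ hu du)[w [QE hw dw ex']]]; subst Q.
apply: (representative_unique rW rQ); rewrite -embB; apply/coboundaryE.
by rewrite -(subrKA u); apply: exactD; rewrite -opprB; exact: exactN.
Qed.

(** Representatives are closed, so the operation performed on them gives a cocycle, which
    [normal_form] brings back to a representative by the relations. *)
Lemma class_op_normal_form (op : mvf R 3 -> mvf R 3 -> mvf R 3) (deg : nat -> nat -> nat)
    p q U V : descends heis op deg -> representative p U -> representative q V ->
  exists W : mvf R 3, [/\ representative (deg p q) W,
    derivable_from heis (@heis_relation R) (deg p q) (op U V) W &
    class_op heis op (deg p q) (pclass heis p U) (pclass heis q V)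
      = pclass heis (deg p q) W].
Proof.
move=> dop /representative_cocycle cU /representative_cocycle cV.
have [cUV ->] := dop _ _ _ _ cU cV; have [W [rW dW]] := normal_form cUV.
by exists W; split=> //; exact: derivable_pclass.
Qed.

End Conclusions.

Theorem mainTheorem1 (R : realType) :
  (* heis is a Poisson structure *)
  schouten (@heis R) heis = 0 /\
  (* Casimir functions *)
  (forall h : 'rV[R]_3 -> R, smooth h ->
     (schouten heis (fn h) = 0 <->
      exists2 f : R -> R, smooth f & h = of_z f)) /\
  (* representatives *)
  (forall (p : nat) (P : mvf R 3), representative p P -> cocycle heis p P) /\
  (forall (p : nat) (c : set (mvf R 3)), cohomology heis p c ->
     exists! P : mvf R 3, representative p P /\ c P) /\
  (* relations *)
  (forall (p : nat) (P Q : mvf R 3), heis_relation p P Q ->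
     cocycle heis p P -> pclass heis p P = pclass heis p Q) /\
  (* the operations on cohomology are computed on representatives, and the
     relations suffice to bring the results back to representatives *)
  descends (@heis R) (@wedge R 3) addn /\
  descends (@heis R) (@schouten R 3) bracket_deg /\
  (forall (p q : nat) (U V : mvf R 3),
     representative p U -> representative q V ->
     exists W : mvf R 3, [/\ representative (p + q) W,
       derivable_from heis (@heis_relation R) (p + q) (wedge U V) W &
       class_op heis (@wedge R 3) (p + q) (pclass heis p U) (pclass heis q V)
         = pclass heis (p + q) W]) /\
  (forall (p q : nat) (U V : mvf R 3),
     representative p U -> representative q V ->
     exists W : mvf R 3, [/\ representative (bracket_deg p q) W,
       derivable_from heis (@heis_relation R) (bracket_deg p q)
         (schouten U V) W &
       class_op heis (@schouten R 3) (bracket_deg p q)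
           (pclass heis p U) (pclass heis q V)
         = pclass heis (bracket_deg p q) W]).
Proof.
(* The only coefficient of [heis] is the one of d_x d_y, which does not enter the formula for its
   differential. *)
split; first by rewrite [X in schouten _ X]heisE schouten_heis -emb0 (mvecE (heis_mv _)) !heis_bset d_mvec
  !der0 !addr0 !mulr0 subr0 oppr0 mvec0.
split; first exact: casimirP.
split; first exact: representative_cocycle.
split; first exact: cohomology_representative.
split.
  move=> p P Q rel cP; apply: derivable_pclass; exact: Der_rel.
split; first exact: descends_wedge.
split; first exact: descends_schouten.
by split=> p q U V; apply: class_op_normal_form;
  [exact: descends_wedge|exact: descends_schouten].
Qed.
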